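(* Let $n\ge 1$ be an integer and let $\rho,\nu\in\mathcal{D}(\mathbb{C}^n)$ be normalized quantum states. Let $$f=\mathrm{Tr}\left[(xx^*-yy^* )\,\overline{(xx^*-yy^* )}\right]\in\mathbb{C}[x,\overline{x},y,\overline{y}],$$ where the overline denotes the entrywise complex conjugate, and let $\mathbf{X}=\{(x,y)\in\mathbb{C}^n\times\mathbb{C}^n:\|x\|=\|y\|=1\}$ with quadratic module $\mathcal{Q}(\mathbf{X})$ and truncated quadratic modules $\mathcal{Q}(\mathbf{X})_{2t}$. For each integer $t\ge 2$ define $$W_2^2(\rho,\nu)_t=\inf\left\{L(f)\;:\;L:\mathbb{C}[x,\overline{x},y,\overline{y}]_{2t}\to\mathbb{C}\text{ Hermitian linear},\ L(xx^* )=\rho,\ L(yy^* )=\nu,\ L\ge 0\text{ on }\mathcal{Q}(\mathbf{X})_{2t}\right\},$$ $$D(\rho,\nu)_t=\sup\left\{\mathrm{Tr}(\rho\Lambda+\nu\Gamma)\;:\;\Lambda,\Gamma\in\mathbb{C}^{n\times n},\ \Lambda^*=\Lambda,\ \Gamma^*=\Gamma,\ f-x^*\Lambda x-y^*\Gamma y\in\mathcal{Q}(\mathbf{X})_{2t}\right\},$$ and let $$W_2^2(\rho,\nu)_\infty=\inf\left\{L(f)\;:\;L:\mathbb{C}[x,\overline{x},y,\overline{y}]\to\mathbb{C}\text{ Hermitian linear},\ L(xx^* )=\rho,\ L(yy^* )=\nu,\ L\ge 0\text{ on }\mathcal{Q}(\mathbf{X})\right\}.$$ Then for every integer $t\ge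 2$ there is no duality gap, i.e. $W_2^2(\rho,\nu)_t=D(\rho,\nu)_t$. In addition, $$\lim_{t\to\infty}W_2^2(\rho,\nu)_t=W_2^2(\rho,\nu)_\infty=W_2^2(\rho,\nu),$$ where $W_2(\rho,\nu)$ is the order $2$ quantum Wasserstein distance between $\rho$ and $\nu$ and $W_2^2(\rho,\nu)$ denotes its square.
   Context: For a complex matrix $A$, $A^*$ denotes its conjugate transpose, $\overline{A}$ its entrywise complex conjugate (without transposition) and $\mathrm{Tr}$ the trace; $\|\cdot\|$ is the Euclidean norm on $\mathbb{C}^n$. Vectors of $\mathbb{C}^n$ are column vectors, so $xx^*$ is an $n\times n$ matrix. $\mathcal{D}(\mathbb{C}^n)$ is the set of normalized quantum states, i.e. Hermitian positive semidefinite matrices in $\mathbb{C}^{n\times n}$ with trace $1$. Expanded, the cost is $f=\left|\sum_{i=1}^n x_i^2\right|^2+\left|\sum_{i=1}^n y_i^2\right|^2-2\left|\sum_{i=1}^n x_iy_i\right|^2$. Polynomials. $x=(x_1,\dots,x_n)$ and $y=(y_1,\dots,y_n)$ are vectors of complex variables, $\overline{x},\overline{y}$ their conjugates. $\mathbb{C}[x,\overline{x},y,\overline{y}]$ is the space of polynomials with complex coefficients in the variables $x_i,\overline{x}_i,y_i,\overline{y}_i$, and $\mathbb{C}[x,\overline{x},y,\overline{y}]_{k}$ is the subspace of polynomials of total degree at most $k$ (all variables and conjugate variables counted). The conjugate $\overline{p}$ of a polynomial $p$ is obtained by conjugating the coefficients and exchanging each variable with its conjugate; $p$ is Hermitian if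 $p=\overline{p}$. The entries of $xx^*$ and $yy^*$ are the polynomials $x_i\overline{x}_j$ and $y_i\overline{y}_j$, and $\|x\|^2=\sum_i x_i\overline{x}_i$, $\|y\|^2=\sum_i y_i\overline{y}_i$. A sum of Hermitian squares is a finite sum of polynomials of the form $\overline{p}\,p$. Quadratic modules. The set $\mathbf{X}$ is described by the Hermitian polynomial inequalities $g_j\ge 0$, $j=1,\dots,4$, with $g_1=1-\|x\|^2$, $g_2=\|x\|^2-1$, $g_3=1-\|y\|^2$, $g_4=\|y\|^2-1$; put $g_0=1$. Then $\mathcal{Q}(\mathbf{X})=\left\{\sum_{j=0}^4\sigma_jg_j:\sigma_j\text{ sums of Hermitian squares}\right\}$ and $\mathcal{Q}(\mathbf{X})_{2t}=\left\{\sum_{j=0}^4\sigma_jg_j:\sigma_j\text{ sums of Hermitian squares},\ \deg(\sigma_jg_j)\le 2t\right\}$. Functionals. A linear functional $L$ on $\mathbb{C}[x,\overline{x},y,\overline{y}]$ or $\mathbb{C}[x,\overline{x},y,\overline{y}]_{2t}$ is Hermitian if $L(\overline{p})=\overline{L(p)}$ for all $p$ in its domain. $L$ is applied entrywise to matrices of polynomials. Wasserstein distance. A quantum transport plan between $\rho,\nu\in\mathcal{D}(\mathbb{C}^n)$ is a finite set of triples $\{(\omega_\ell,u_\ell,v_\ell)\}_\ell$ with $\omega_\ell>0$, $\sum_\ell\omega_\ell=1$, $u_\ell,v_\ell\in\mathbb{C}^n$, $\|u_\ell\|=\|v_\ell\|=1$, such that $\sum_\ell\omega_\ell u_\ell u_\ell^*=\rho$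 and $\sum_\ell\omega_\ell v_\ell v_\ell^*=\nu$. The set of all such plans is $Q(\rho,\nu)$. The order $2$ quantum transport cost of $e=\{(\omega_\ell,u_\ell,v_\ell)\}_\ell\in Q(\rho,\nu)$ is $$T_2(e)=\sum_\ell\omega_\ell\,\mathrm{Tr}\left[(u_\ell u_\ell^*-v_\ell v_\ell^* )\,\overline{(u_\ell u_\ell^*-v_\ell v_\ell^* )}\right],$$ and the order $2$ quantum Wasserstein distance is $W_2(\rho,\nu)=\left(\inf_{e\in Q(\rho,\nu)}T_2(e)\right)^{1/2}$, so that $W_2^2(\rho,\nu)=\inf_{e\in Q(\rho,\nu)}T_2(e)$. *)

(* Defs.v *)
From HB Require Import structures.
From mathcomp Require Import all_boot all_order all_algebra.
From mathcomp Require Import all_classical all_reals all_analysis.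
From mathcomp Require Import complex.
(* The notations of mpoly clash with those of MathComp-Analysis. *)
From mathcomp Require Import -(notations) mpoly.

Set Implicit Arguments.
Unset Strict Implicit.
Unset Printing Implicit Defensive.
Import Order.TTheory GRing.Theory Num.Theory.

Local Open Scope classical_set_scope.
Local Open Scope ring_scope.
Local Open Scope complex_scope.
Local Open Scope sesquilinear_scope.

(* [A ^t*] is the conjugate transpose; on [R[i]], [0 <= z] means that z is real
   and nonnegative. *)

Definition density (R : realType) (n : nat) (A : 'M[R[i]]_n) : Prop :=
  [/\ A ^t* = A,
      forall v : 'cV[R[i]]_n, 0 <= (v ^t* *m A *m v) ord0 ord0
    & \tr A = 1].

Definition enorm (R : realType) (n : nat) (u : 'cV[R[i]]_n) : R[i] :=
  sqrtC (\sum_(i < n) `|u i ord0| ^+ 2).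

(* The conjugation in the second factor is entrywise, without transposition.  The
   cost is real but may be negative: it equals -2 for u = (1, i)/sqrt 2 and
   v = (1, -i)/sqrt 2. *)
Definition pure_cost (R : realType) (n : nat) (u v : 'cV[R[i]]_n) : R[i] :=
  let M := u *m u ^t* - v *m v ^t* in \tr (M *m map_mx Num.conj M).

(* A transport plan is a finite family (w_l, u_l, v_l), given as a list. *)
Definition triple (R : realType) (n : nat) : Type :=
  (R * 'cV[R[i]]_n * 'cV[R[i]]_n)%type.

Definition transport_plan (R : realType) (n : nat) (rho nu : 'M[R[i]]_n) :
    set (seq (triple R n)) :=
  [set e : seq (triple R n) | [/\ forall a : triple R n, a \in e ->
                 [/\ 0 < a.1.1, enorm a.1.2 = 1 & enorm a.2 = 1],
               \sum_(a <- e) a.1.1 = 1,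
               \sum_(a <- e) a.1.1%:C *: (a.1.2 *m a.1.2 ^t*) = rho
             & \sum_(a <- e) a.1.1%:C *: (a.2 *m a.2 ^t*) = nu]].

Definition T2 (R : realType) (n : nat) (e : seq (triple R n)) : R[i] :=
  \sum_(a <- e) a.1.1%:C * pure_cost a.1.2 a.2.

Definition W2_cost (R : realType) (n : nat) (rho nu : 'M[R[i]]_n) : R :=
  inf [set complex.Re (T2 e) | e in transport_plan rho nu].

(* The infimum may be negative (see [pure_cost]), so the square root is the
   complex one; its square is always the infimum. *)
Definition W2 (R : realType) (n : nat) (rho nu : 'M[R[i]]_n) : R[i] :=
  sqrtC (W2_cost rho nu)%:C.

Lemma W2_sqr (R : realType) (n : nat) (rho nu : 'M[R[i]]_n) :
  W2 rho nu ^+ 2 = (W2_cost rho nu)%:C.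
Proof. exact: sqrtCK. Qed.

(* C[x, xbar, y, ybar]: 4n independent variables, in the order of the blocks
   x, xbar, y, ybar. *)
Notation cpoly R n := (mpoly (n + n + (n + n)) R[i]).

Definition Xpoly (R : realType) (n : nat) (k : 'I_(n + n + (n + n))) :
  cpoly R n := mpolyX R[i] (mnm1 k).

Definition xvec (R : realType) (n : nat) : 'cV[cpoly R n]_n :=
  \col_(i < n) Xpoly R (lshift (n + n) (lshift n i)).

Definition yvec (R : realType) (n : nat) : 'cV[cpoly R n]_n :=
  \col_(i < n) Xpoly R (rshift (n + n) (lshift n i)).

Definition swap_half (n : nat) (k : 'I_(n + n)) : 'I_(n + n) :=
  match fintype.split k with inl i => rshift n i | inr i => lshift n i end.

Definition swap_conj (n : nat) (k : 'I_(n + n + (n + n))) :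
    'I_(n + n + (n + n)) :=
  match fintype.split k with
  | inl i => lshift (n + n) (swap_half i)
  | inr i => rshift (n + n) (swap_half i)
  end.

Definition pconj (R : realType) (n : nat) (p : cpoly R n) : cpoly R n :=
  mmap (@mpolyC _ _ \o Num.conj) (fun k => Xpoly R (swap_conj k)) p.

Definition padj (R : realType) (n k l : nat) (A : 'M[cpoly R n]_(k, l)) :
  'M[cpoly R n]_(l, k) := (map_mx (@pconj R n) A)^T.

Definition cost_poly (R : realType) (n : nat) : cpoly R n :=
  let M := xvec R n *m padj (xvec R n) - yvec R n *m padj (yvec R n) in
  \tr (M *m map_mx (@pconj R n) M).

Definition qform (R : realType) (n : nat) (x : 'cV[cpoly R n]_n)
    (A : 'M[R[i]]_n) : cpoly R n :=
  (padj x *m map_mx (@mpolyC _ _) A *m x) ord0 ord0.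

Definition sqnorm (R : realType) (n : nat) (x : 'cV[cpoly R n]_n) : cpoly R n :=
  \sum_(i < n) x i ord0 * pconj (x i ord0).

(* [mmeasure (@mdeg _) p] is 1 + deg p, and 0 for p = 0. *)
Definition deg_le (R : realType) (n k : nat) : set (cpoly R n) :=
  [set p | (mmeasure (@mdeg _) p <= k.+1)%N].

Definition sum_herm_squares (R : realType) (n : nat) : set (cpoly R n) :=
  [set s | exists ps : seq (cpoly R n), s = \sum_(p <- ps) pconj p * p].

(* The generators g_0 = 1, g_1, ..., g_4 describing ||x|| = ||y|| = 1. *)
Definition sphere_gens (R : realType) (n : nat) : 5.-tuple (cpoly R n) :=
  [tuple 1; 1 - sqnorm (xvec R n); sqnorm (xvec R n) - 1;
            1 - sqnorm (yvec R n); sqnorm (yvec R n) - 1].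

Definition qmodule (R : realType) (n : nat) : set (cpoly R n) :=
  [set q | exists2 s : 'I_5 -> cpoly R n,
      forall j, sum_herm_squares (s j)
    & q = \sum_(j < 5) s j * tnth (sphere_gens R n) j].

Definition qmodule_trunc (R : realType) (n k : nat) : set (cpoly R n) :=
  [set q | exists2 s : 'I_5 -> cpoly R n,
      forall j, sum_herm_squares (s j) /\
                deg_le k (s j * tnth (sphere_gens R n) j)
    & q = \sum_(j < 5) s j * tnth (sphere_gens R n) j].

(* [L] stands for a functional on the subspace [D] of polynomials: it is a total
   function of which only the values on [D] are constrained and used.  [Q] is
   the part of [D] on which [L] has to be nonnegative. *)
Definition feasible (R : realType) (n : nat) (D Q : set (cpoly R n))
    (rho nu : 'M[R[i]]_n) : set (cpoly R n -> R[i]) :=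
  [set L | [/\ forall (c : R[i]) (p q : cpoly R n), D p -> D q ->
                 L (c *: p + q) = c * L p + L q,
               forall p : cpoly R n, D p -> L (pconj p) = (L p)^*%R,
               map_mx L (xvec R n *m padj (xvec R n)) = rho,
               map_mx L (yvec R n *m padj (yvec R n)) = nu
             & forall q : cpoly R n, Q q -> 0 <= L q]].

(* The optimal values are taken in the extended reals; the objectives L(f) and
   Tr(rho Lambda + nu Gamma) are real on the feasible sets. *)
Definition moment_value (R : realType) (n : nat) (D Q : set (cpoly R n))
    (rho nu : 'M[R[i]]_n) : \bar R :=
  ereal_inf [set (complex.Re (L (cost_poly R n)))%:E
            | L in feasible D Q rho nu].

(* For 2t < 4 the cost is outside the domain of L and the value is meaningless. *)
Definition W2sq_trunc (R : realType) (n : nat) (rho nu : 'M[R[i]]_n) (t : nat) :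
    \bar R :=
  moment_value (deg_le (2 * t)) (qmodule_trunc (2 * t)) rho nu.

Definition W2sq_infty (R : realType) (n : nat) (rho nu : 'M[R[i]]_n) : \bar R :=
  moment_value setT (@qmodule R n) rho nu.

Definition dual_feasible (R : realType) (n k : nat) :
    set ('M[R[i]]_n * 'M[R[i]]_n) :=
  [set LG | [/\ LG.1 ^t* = LG.1, LG.2 ^t* = LG.2
              & qmodule_trunc k (cost_poly R n - qform (xvec R n) LG.1
                                               - qform (yvec R n) LG.2)]].

Definition dual_trunc (R : realType) (n : nat) (rho nu : 'M[R[i]]_n) (t : nat) :
    \bar R :=
  ereal_sup [set (complex.Re (\tr (rho *m LG.1 + nu *m LG.2)))%:E
            | LG in @dual_feasible R n (2 * t)].

(* Main.v *)
(* The moment functionals of all orders can be compared with transport plans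
   through three facts.
   (1) 1 is an order unit of every (truncated) quadratic module: |m|^2 <= 1 for
   each monomial m, because 1 - |x_i|^2 is a sum of squares plus a generator.
   So a point outside the cone spanned by the quadratic module and the forms
   x* A x + y* B y with Tr(rho A + nu B) = 0 is separated from it by a functional
   normalized at 1 (Zorn, no topology), and this functional is feasible.  This
   gives the absence of a duality gap at every order, and also shows that the
   untruncated value is the limit of the truncated dual values, since a
   certificate in the quadratic module uses finitely many polynomials.
   (2) A Hermitian polynomial that is positive on the product of spheres lies in
   the quadratic module.  Adding a multiple of the squared defect of the sphere
   equations makes it positive on a box; the squares |1 + i^s x_k|^2, suitably
   scaled, sum to 1 modulo the sphere equations and span the coordinates linearly,
   so that Polya's theorem writes the polynomial as a combination of products of
   these squares with nonnegative coefficients.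
   (3) By Tchakaloff's theorem a functional that is nonnegative on polynomials
   positive on the (compact) product of spheres agrees on any finite family of
   polynomials with a finite convex combination of evaluations, that is, with a
   transport plan. *)
Require Import Defs.
From HB Require Import structures.
From mathcomp Require Import all_boot all_order all_algebra.
From mathcomp Require Import all_classical all_reals all_analysis.
From mathcomp Require Import complex lra ring.
From mathcomp Require Import -(notations) mpoly.
Set Implicit Arguments.
Unset Strict Implicit.
Unset Printing Implicit Defensive.
Import Order.TTheory GRing.Theory Num.Theory.
Import numFieldNormedType.Exports.
Local Open Scope classical_set_scope.
Local Open Scope complex_scope.
Local Open Scope ring_scope.
Local Open Scope sesquilinear_scope.

(** * Separation from a convex cone with an order unit *)

(** Two obstacles shape the proof. For duality, no closedness of the truncated modules and no
    interior feasible point is established, so the usual closed-cone or Slater arguments are not at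
    hand. The alternative is therefore stated at an exact real level [c]: either [f - c] lies in the
    cone, or a functional gives it a value [<= 0]. This weak inequality suffices, because
    normalization at the order unit keeps the functional from vanishing. For positivity, Polya's
    theorem speaks about nonnegative real variables of sum 1, while the coordinates here are
    complex. The scaled squares [Y i] take the place of those variables. The linear map that
    recovers the coordinates sends the simplex to points that need not lie on the spheres, which is
    why positivity has to be extended to a box first. *)

Section ComplexScaling.
Variables (R : realType) (V : lmodType R[i]).
Implicit Types (p q : V) (a b : R).

(** This identity and the next reduce complex linearity of [p |-> phi p + i phi (- i p)] to real
    linearity of [phi]. *)
Lemma scale_complex_split a b p q :
  (a +i* b)%C *: p + q = a%:C *: p + (b%:C *: ('i *: p) + q).
Proof.
rewrite addrA scalerA -scalerDl; congr (_ *: _ + _).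
by rewrite [LHS]complexE /= mulrC.
Qed.

Lemma scaleNi_split a b p q :
  - 'i *: (a%:C *: p + (b%:C *: ('i *: p) + q)) =
  a%:C *: (- 'i *: p) + (b%:C *: p + - 'i *: q).
Proof.
rewrite !scalerDr; congr (_ + (_ + _)); first by rewrite !scalerA mulrC.
by rewrite !scalerA -mulrA mulrCA mulNr -expr2 sqrCi opprK mulr1.
Qed.

Lemma scale_half_rect p q :
  p = 2^-1 *: (p + q) + 'i *: (2^-1 *: (- 'i *: p + 'i *: q)).
Proof.
rewrite !scalerDr !scalerA.
have ii c : 'i * (c * - 'i) = c :> R[i].
  by rewrite mulrCA mulrN -expr2 sqrCi opprK mulr1.
have ii' c : 'i * (c * 'i) = - c :> R[i] by rewrite mulrCA -expr2 sqrCi mulrN1.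
rewrite -!mulrA ii ii' addrACA scaleNr subrr addr0 -scalerDl.
have -> : 2^-1 + 2^-1 = 1 :> R[i] by field.
by rewrite scale1r.
Qed.

End ComplexScaling.

Section ConeSeparation.
Variables (R : realType) (V : lmodType R[i]).
Implicit Types (S K M : set V) (r : R).

(** Convexity is over the reals although [V] is a complex module; below, [S] plays the role of the
    real subspace of Hermitian polynomials. *)
Definition real_cone K :=
  (forall p q, K p -> K q -> K (p + q)) /\
  (forall r p, 0 <= r -> K p -> K (r%:C *: p)).

Lemma real_cone0 K p : real_cone K -> K p -> K 0.
Proof. by move=> [_ Kz] /(Kz 0 _ (lexx 0)); rewrite rmorph0 scale0r. Qed.

Variables (S K : set V) (e p : V).
Hypothesis S_sub : forall r q q', S q -> S q' -> S (r%:C *: q + q').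
Hypothesis coneK : real_cone K.
Hypothesis KS : K `<=` S.
Hypothesis Ke : K e.
Hypothesis unitK : forall q, S q -> exists r, K (r%:C *: e + q).
Hypothesis Sp : S p.
Hypothesis NKp : ~ K p.

Let S0 : S 0. Proof. exact/KS/(real_cone0 coneK Ke). Qed.
Let SD q q' : S q -> S q' -> S (q + q').
Proof. by move=> h /(S_sub 1 h); rewrite scale1r. Qed.
Let SZ r q : S q -> S (r%:C *: q).
Proof. by move=> h; have := S_sub r h S0; rewrite addr0. Qed.
Let SN q : S q -> S (- q).
Proof. by move=> /(SZ (-1)); rewrite rmorphN1 scaleN1r. Qed.

(* A maximal good cone [M] satisfies [M `|` - M = S]; [psi q] is then the largest
   [r] such that [q - r e] lies in [M]. *)
Let good M := [/\ real_cone M, M `<=` S, K `<=` M, M (- p) & ~ M (- e)].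

Let K1 : set V := [set k - r%:C *: p | k in K & r in [set r | 0 <= r]].

Let good_K1 : good K1.
Proof.
split.
- split=> [_ _ [k Kk [r /= r0 <-]] [k' Kk' [r' /= r'0 <-]]|s _ s0 [k Kk [r /= r0 <-]]].
    exists (k + k'); first exact: coneK.1.
    exists (r + r'); first by rewrite /= addr_ge0.
    by rewrite rmorphD scalerDl opprD addrACA.
  exists (s%:C *: k); first exact: coneK.2.
  exists (s * r); first by rewrite /= mulr_ge0.
  by rewrite scalerBr rmorphM scalerA.
- by move=> _ [k Kk [r r0 <-]]; apply/SD/SN/SZ => //; exact: KS.
- by move=> k Kk; exists k => //; exists 0; rewrite /= ?scale0r ?subr0.
- exists 0; first exact: (real_cone0 coneK Ke).
  by exists 1; rewrite /= ?scale1r ?sub0r.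
- move=> [k Kk [r /= r0]] /(congr1 (fun x => x + e + r%:C *: p)).
  rewrite addNr add0r addrAC addrNK => kE.
  (* From [- e = k - r p]: if [r > 0] then [p = (k + e) / r] is in [K]; if [r = 0] then both [e] and
     [- e] are in [K], and some [s e + p] in [K] can be corrected to [p]. *)
  have [r00|rn0] := eqVneq r 0.
    move: kE; rewrite r00 rmorph0 scale0r => ke0; apply: NKp.
    have [s Ks] := unitK Sp.
    have Kme : K (- e) by have -> : - e = k; [apply/eqP; rewrite eq_sym -addr_eq0 ke0|].
    have [s0|s0] := leP 0 s.
      have := coneK.1 _ _ Ks (coneK.2 _ _ s0 Kme).
      by rewrite scalerN addrAC subrr add0r.
    have ns0 : 0 <= - s by rewrite oppr_ge0 ltW.
    have := coneK.1 _ _ Ks (coneK.2 _ _ ns0 Ke).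
    by rewrite rmorphN scaleNr addrAC subrr add0r.
  apply: NKp.
  have -> : p = r^-1%:C *: (k + e).
    by rewrite kE scalerA -rmorphM mulVf // scale1r.
  by apply: coneK.2; [rewrite invr_ge0|exact: coneK.1].
Qed.

Let maximal_good : exists M, good M /\ forall B, M `<` B -> ~ good B.
Proof.
pose P := [set M | M = set0 \/ good M].
have [F FP Ftot|M [PM maxM]] := @Zorn_bigcup V P.
  have [[M0 [FM0 gM0]]|noM] := pselect (exists M, F M /\ good M); last first.
    left; apply/seteqP; split=> // x [M FM Mx] /=.
    case: (FP _ FM) => [ME|gM]; first by rewrite ME in Mx.
    by case: noM; exists M.
  have gF M x : F M -> M x -> good M.
    by move=> FM Mx; case: (FP _ FM) => // ME; rewrite ME in Mx.
  right; split.
  - split=> [x y [M FM Mx] [N FN Ny]|r x r0 [M FM Mx]].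
      have [MN|NM] := Ftot _ _ FM FN.
        by exists N => //; have [[h _] _ _ _ _] := gF _ _ FN Ny; apply: (h) => //; exact: MN.
      by exists M => //; have [[h _] _ _ _ _] := gF _ _ FM Mx; apply: (h) => //; exact: NM.
    by exists M => //; have [[_ h] _ _ _ _] := gF _ _ FM Mx; exact: h.
  - by move=> x [M FM Mx]; have [_ h _ _ _] := gF _ _ FM Mx; exact: h.
  - by move=> x Kx; exists M0 => //; case: gM0 => _ _ h _ _; exact: h.
  - by exists M0 => //; case: gM0.
  - by move=> [M FM Mx]; have [_ _ _ _ h] := gF _ _ FM Mx; exact: h.
case: PM => [M0|gM].
  exfalso; apply: (maxM K1); last by right; exact: good_K1.
  rewrite M0; split; first exact: sub0set.
  by move=> h; have := h e; apply; case: good_K1 => _ _ h' _ _; exact: h'.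
by exists M; split=> // B MB gB; apply: (maxM B MB); right.
Qed.

Lemma cone_separation : exists psi : V -> R,
  [/\ forall r q q', S q -> S q' -> psi (r%:C *: q + q') = r * psi q + psi q',
      forall q, K q -> 0 <= psi q, psi e = 1 & psi p <= 0].
Proof.
have [M [[[MD MZ] MS KM Mp NMe] maxM]] := maximal_good.
have Me : M e by exact: KM.
(* If [q] is not in [M], the cone [M + R_+ q] is not good, and only its avoidance of [- e] can fail,
   so [- e = m + s q] with [s > 0]. The same for [- q] gives [- e = m' - s' q]; eliminating [q] puts
   [- e] in [M]. *)
have total q : S q -> M q \/ M (- q).
  move=> Sq; have [Mq|NMq] := pselect (M q); first by left.
  have [Mq'|NMq'] := pselect (M (- q)); first by right.
  have ext q1 : S q1 -> ~ M q1 ->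
      exists m s, [/\ M m, 0 < s & - e = m + s%:C *: q1].
    move=> Sq1 NMq1.
    pose B := [set m + s%:C *: q1 | m in M & s in [set s | 0 <= s]].
    have MB : M `<=` B by move=> m Mm; exists m => //; exists 0; rewrite /= ?scale0r ?addr0.
    have M0 : M 0 by rewrite -(scale0r e); exact: (MZ 0).
    have : ~ good B.
      apply: (maxM); split=> // BM; apply: NMq1; apply: BM.
      by exists 0 => //; exists 1; rewrite /= ?scale1r ?add0r.
    move=> NgB; have [[m Mm [s /= s0 ms]]|NBe] := pselect (B (- e)); last first.
      case: NgB; split=> //; last 3 first.
      - by move=> _ [k Mk [r r0 <-]]; apply/SD/SZ => //; exact: MS.
      - by move=> x Kx; apply: (MB); exact: KM.
      - exact: MB.
      split=> [_ _ [k Mk [r /= r0 <-]] [k' Mk' [r' /= r'0 <-]]|s _ s0 [k Mk [r /= r0 <-]]].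
        exists (k + k'); first exact: MD.
        exists (r + r'); first by rewrite /= addr_ge0.
        by rewrite rmorphD scalerDl addrACA.
      exists (s%:C *: k); first exact: MZ.
      exists (s * r); first by rewrite /= mulr_ge0.
      by rewrite scalerDr rmorphM scalerA.
    exists m, s; split => //; rewrite lt_neqAle s0 andbT eq_sym; apply/eqP => s00.
    by apply: (NMe); rewrite -ms s00 rmorph0 scale0r addr0.
  have [m [s [Mm s0 ms]]] := ext _ Sq NMq.
  have [m' [s' [Mm' s'0 ms']]] := ext _ (SN Sq) NMq'.
  exfalso; apply: (NMe).
  have -> : - e = ((s + s')^-1)%:C *: (s'%:C *: m + s%:C *: m').
    have ss : s + s' != 0 by rewrite gt_eqF // addr_gt0.
    have -> : s'%:C *: m + s%:C *: m' = (s + s')%:C *: - e; last first.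
      by rewrite scalerA -rmorphM mulVf // scale1r.
    rewrite rmorphD scalerDl {1}ms' {1}ms !scalerDr !scalerN !scalerA (mulrC s'%:C).
    by rewrite addrACA addNr addr0 addrC.
  by apply: (MZ); [rewrite invr_ge0 addr_ge0 // ltW|apply: (MD); apply: (MZ) => //; exact: ltW].
pose low q := [set r | M (q - r%:C *: e)].
pose psi q := sup (low q).
have M0 : M 0 by rewrite -(scale0r e); exact: (MZ 0).
have MeN r : M (r%:C *: e) -> 0 <= r.
  move=> h; rewrite leNgt; apply/negP => r0; apply: (NMe).
  have -> : - e = (- r)^-1%:C *: (r%:C *: e).
    by rewrite scalerA -rmorphM invrN mulNr mulVf ?lt_eqF // rmorphN1 scaleN1r.
  by apply: (MZ) => //; rewrite invr_ge0 oppr_ge0 ltW.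
have lowP q : S q -> has_sup (low q).
  move=> Sq; split.
    have [r Kr] := unitK Sq; exists (- r).
    by rewrite /low /= rmorphN scaleNr opprK addrC; exact: KM.
  have [r Kr] := unitK (SN Sq); exists r => t tq.
  rewrite -subr_ge0; apply: MeN.
  have -> : (r - t)%:C *: e = (r%:C *: e - q) + (q - t%:C *: e).
    by rewrite rmorphB scalerBl addrA addrNK.
  by apply: (MD) => //; exact: KM.
have lowle q r : S q -> M (q - r%:C *: e) -> r <= psi q.
  by move=> Sq h; apply: sup_upper_bound => //; exact: lowP.
have psi_le q r : S q -> M (r%:C *: e - q) -> psi q <= r.
  move=> Sq h; apply: ge_sup; first by case: (lowP _ Sq).
  move=> t tq; rewrite -subr_ge0; apply: MeN.
  have -> : (r - t)%:C *: e = (r%:C *: e - q) + (q - t%:C *: e).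
    by rewrite rmorphB scalerBl addrA addrNK.
  exact: MD.
(* A supremum of this kind is only superadditive; oddness, which comes from totality, turns the
   inequality into an equality. *)
have psiD_ge q q' : S q -> S q' -> psi q + psi q' <= psi (q + q').
  move=> Sq Sq'; rewrite leNgt; apply/negP => lt.
  pose d := (psi q + psi q' - psi (q + q')) / 3.
  have d0 : 0 < d by rewrite divr_gt0 // subr_gt0.
  have [t tq tl] := sup_adherent d0 (lowP _ Sq).
  have [t' tq' tl'] := sup_adherent d0 (lowP _ Sq').
  have /lowle h : M (q + q' - (t + t')%:C *: e).
    by rewrite rmorphD scalerDl opprD addrACA; exact: MD.
  have := h (SD Sq Sq'); rewrite -/(psi q) -/(psi q') in tl tl' *.
  rewrite /d in tl tl'; lra.
have psiN q : S q -> psi (- q) = - psi q.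
  move=> Sq; apply/eqP; rewrite eq_le; apply/andP; split.
    have := psiD_ge _ _ Sq (SN Sq); rewrite subrr.
    have : psi 0 <= 0 by apply: (psi_le) => //; rewrite scale0r subr0.
    lra.
  rewrite leNgt; apply/negP => lt.
  (* Half of the supposed gap: [q - (psi q + m) e] lies above the supremum, so by totality its
     opposite is in [M], which makes the gap at most [m]. *)
  pose m := (- psi q - psi (- q)) / 2.
  have : ~ M (q - (psi q + m)%:C *: e).
    by move=> /lowle => /(_ Sq); rewrite /m; lra.
  have [|//|] := total (q - (psi q + m)%:C *: e); first exact/SD/SN/SZ/KS.
  rewrite opprB addrC => h _.
  have : psi q + m >= - psi (- q); last by rewrite /m; lra.
  rewrite lerNl; apply: (lowle); first exact: SN.
  by rewrite rmorphN scaleNr opprK.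
have psiD q q' : S q -> S q' -> psi (q + q') = psi q + psi q'.
  move=> Sq Sq'; apply/eqP; rewrite eq_le psiD_ge // andbT.
  have := psiD_ge _ _ (SN Sq) (SN Sq'); rewrite -opprD !psiN //; last exact: SD.
  lra.
have psiZ_ge r q : 0 < r -> S q -> r * psi q <= psi (r%:C *: q).
  move=> r0 Sq; rewrite mulrC -ler_pdivlMr //; apply: ge_sup; first by case: (lowP _ Sq).
  move=> t tq; rewrite ler_pdivlMr // mulrC; apply: (lowle); first exact: SZ.
  by rewrite rmorphM -scalerA -scalerBr; apply: (MZ) => //; exact: ltW.
have psiZ r q : 0 <= r -> S q -> psi (r%:C *: q) = r * psi q.
  rewrite le_eqVlt => /orP[/eqP <-|r0] Sq.
    rewrite scale0r mul0r.
    by have := psiD 0 0 S0 S0; rewrite addr0; lra.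
  apply/eqP; rewrite eq_le psiZ_ge // andbT.
  have := psiZ_ge _ _ r0 (SN Sq).
  by rewrite scalerN !psiN //; [lra|exact: SZ].
exists psi; split.
- move=> r q q' Sq Sq'; rewrite psiD //; last exact: SZ.
  congr (_ + _); have [r0|r0] := leP 0 r; first exact: psiZ.
  have := @psiZ (- r) q; rewrite rmorphN scaleNr psiN; last exact: SZ.
  move=> h; have := h _ Sq; rewrite mulNr => /(_ _)/oppr_inj; apply.
  by rewrite oppr_ge0 ltW.
- by move=> q Kq; apply: (lowle); [exact: KS|rewrite scale0r subr0; exact: KM].
- apply/eqP; rewrite eq_le; apply/andP; split.
    by apply: (psi_le); [exact: KS|rewrite scale1r subrr].
  by apply: (lowle); [exact: KS|rewrite scale1r subrr].
- by apply: (psi_le) => //; rewrite scale0r sub0r.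
Qed.

End ConeSeparation.

(** * Polya's theorem *)

(** In [polya] this serves twice: for polynomials, with [\sum_i Y i] at the positions missed by [J],
    and for scalar coefficients, with 1 there. *)
Lemma prod_pick_inj (B : comNzRingType) (d M : nat) (J : 'I_d -> 'I_M)
    (g : 'I_d -> B) (g0 : B) : injective J ->
  \prod_(r < M) (if [pick j | J j == r] is Some j then g j else g0) =
  (\prod_(j < d) g j) * g0 ^+ (M - d).
Proof.
move=> Jinj; rewrite (bigID (fun r => r \in [set J j | j : 'I_d])) /=.
congr (_ * _).
  rewrite big_imset /=; last by move=> i j _ _; exact: Jinj.
  apply: eq_big => // j _; case: pickP => [k /eqP/Jinj -> //|/(_ j)].
  by rewrite eqxx.
rewrite (eq_bigr (fun=> g0)) => [|r rJ]; last first.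
  by case: pickP => // k /eqP Jk; rewrite -Jk imset_f in rJ.
rewrite GRing.prodr_const; congr (_ ^+ _).
rewrite (eq_card (B := ~: [set J j | j : 'I_d])) => [|r]; last by rewrite inE.
by rewrite cardsCs finset.setCK card_ord card_imset // card_ord.
Qed.

(* At most [d ^ 2 * M ^ d.-1] of the maps from ['I_d] to ['I_M] are not injective. *)
Lemma expn_le_ffact (d M : nat) : (d <= M)%N ->
  (M ^ d <= M ^_ d + d ^ 2 * M ^ d.-1)%N.
Proof.
elim: d => [|d IH] dM //; have {}IH := IH (ltnW dM).
have Md : (d ^ 2 * M ^ d.-1 * M = d ^ 2 * M ^ d)%N.
  by case: d {IH dM} => // d; rewrite -mulnA -expnSr.
rewrite expnSr ffactnSr /=.
apply: (@leq_trans ((M ^_ d + d ^ 2 * M ^ d.-1) * M)); first by rewrite leq_mul2r IH orbT.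
rewrite mulnDl Md -{2}(subnK (ltnW dM)) mulnDr -addnA leq_add2l.
apply: (@leq_trans (M ^ d * d + d ^ 2 * M ^ d)).
  rewrite leq_add2r leq_mul2r.
  suff -> : (M ^_ d <= M ^ d)%N by rewrite orbT.
  by elim: (d) => // k IHk; rewrite ffactnSr expnSr leq_mul // leq_subr.
rewrite mulnC -mulnDl leq_mul2r; apply/orP; right.
by rewrite -!mulnn mulSn mulnS leq_add // leq_addl.
Qed.

Section Polya.
Variables (R : realType) (A : comAlgType R[i]) (I : finType) (d : nat).
Variable s : seq (R[i] * ('I_d -> I -> R[i])).

(* [s] encodes the form [F] of degree [d] with value [sum_t c_t prod_j l_(t,j)], the
   [l_(t,j)] being linear forms.  In [F(Y) * (sum_i Y i) ^+ (M - d)], the [d] linear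
   factors can be placed at any [d] distinct positions of a word [w] of length [M].
   Averaging over the placements, the coefficient of [w] becomes, up to O(1/M),
   the value of [F] at the vector of letter frequencies of [w]. *)
Lemma polya (Y : I -> A) (delta : R) : 0 < delta ->
  (forall y : I -> R, (forall i, 0 <= y i) -> \sum_i y i = 1 ->
    delta <= complex.Re (\sum_(t <- s) t.1 * \prod_j \sum_i t.2 j i * (y i)%:C)) ->
  exists N M (b : {ffun 'I_M -> I} -> R[i]),
    (forall w, 0 <= complex.Re (b w)) /\
    (\sum_(t <- s) t.1 *: \prod_j \sum_i t.2 j i *: Y i) * (\sum_i Y i) ^+ N =
    \sum_w b w *: \prod_r Y (w r).
Proof.
move=> delta0 Fpos.
(* The coefficient of the word [v] when the products of linear forms are expanded without collecting
   equal monomials, so that no multinomial coefficients appear. *)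
pose a (v : {ffun 'I_d -> I}) : R[i] := \sum_(t <- s) t.1 * \prod_j t.2 j (v j).
pose C := \sum_v `|complex.Re (a v)|.
(* Chosen so that [delta M^d] dominates [C d^2 M^(d-1)], the bound on what the non-injective
   placements contribute. *)
pose M := (d + (Num.bound (C * (d ^ 2)%:R / delta)).+1)%N.
have dM : (d <= M)%N by exact: leq_addr.
have M0 : (0 < M)%N by rewrite /M addnS.
have MR : 0 < M%:R :> R by rewrite ltr0n.
pose comp (w : {ffun 'I_M -> I}) (J : {ffun 'I_d -> 'I_M}) := [ffun j => w (J j)].
pose inj := [set J : {ffun 'I_d -> 'I_M} | injectiveb J]%SET.
pose b w : R[i] := (#|inj|%:R)^-1 * \sum_(J in inj) a (comp w J).
have cinj : #|inj| = (M ^_ d)%N by rewrite card_inj_ffuns !card_ord.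
have inj0 : (0 < #|inj|)%N by rewrite cinj ffact_gt0.
exists (M - d)%N, M, b; split=> [w|].
  have -> : b w = ((#|inj|%:R)^-1 : R)%:C * \sum_(J in inj) a (comp w J).
    by rewrite /b; congr (_ * _); rewrite fmorphV rmorph_nat.
  have ReM (r : R) (z : R[i]) : complex.Re (r%:C * z) = r * complex.Re z.
    by case: z => x y /=; rewrite mul0r subr0.
  rewrite ReM mulr_ge0 ?invr_ge0 ?ler0n //.
  pose y i : R := #|[set r | w r == i]%SET|%:R / M%:R.
  have y0 i : 0 <= y i by rewrite divr_ge0 ?ler0n.
  have sumw (B : nmodType) (f : I -> B) :
      \sum_(r < M) f (w r) = \sum_i f i *+ #|[set r | w r == i]%SET|.
    rewrite (partition_big w predT) //=; apply: eq_bigr => i _.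
    rewrite (eq_bigr (fun=> f i)) => [|r /eqP -> //].
    by rewrite sumr_const; congr (_ *+ _); apply: eq_card => r; rewrite !inE.
  have y1 : \sum_i y i = 1.
    rewrite -mulr_suml -(sumw _ (fun=> 1)) sumr_const card_ord divff //.
    by rewrite gt_eqF.
  (* Over all maps [J] the positions are independent, so the sum factors into exactly [M^d F(y)];
     the injective part is then found by subtracting the rest. *)
  have allJ : \sum_J a (comp w J) =
      (M%:R ^+ d)%:C * \sum_(t <- s) t.1 * \prod_j \sum_i t.2 j i * (y i)%:C.
    rewrite exchange_big /= mulr_sumr; apply: eq_bigr => t _.
    rewrite -mulr_sumr mulrCA; congr (_ * _).
    transitivity (\sum_(J : {ffun 'I_d -> 'I_M}) \prod_j t.2 j (w (J j))).
      by apply: eq_bigr => J _; apply: eq_bigr => j _; rewrite ffunE.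
    rewrite -(bigA_distr_bigA (fun j r => t.2 j (w r))) /= rmorphXn /=.
    have -> : (M%:R)%:C ^+ d = \prod_(j < d) (M%:R)%:C :> R[i].
      by rewrite GRing.prodr_const card_ord.
    rewrite -big_split /=.
    apply: eq_bigr => j _; rewrite (sumw _ (t.2 j)) mulr_sumr.
    apply: eq_bigr => i _; rewrite mulrCA -rmorphM /= mulrCA divff ?gt_eqF //.
    by rewrite mulr1 rmorph_nat mulr_natr.
  have aC v : complex.Re (a v) <= C.
    apply: le_trans (ler_norm _) _.
    by rewrite /C (bigD1 v) //= lerDl sumr_ge0.
  have ReS (T : finType) (P : pred T) (f : T -> R[i]) :
    complex.Re (\sum_(t | P t) f t) = \sum_(t | P t) complex.Re (f t).
    by apply: (big_morph (@complex.Re R)) => // -[? ?] [].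
  have /(congr1 (@complex.Re R)) := allJ.
  rewrite ReM (bigID (mem inj)) /= raddfD /= => H.
  have C0 : 0 <= C by rewrite sumr_ge0.
  have bad : complex.Re (\sum_(J | J \notin inj) a (comp w J)) <= C * (d ^ 2 * M ^ d.-1)%:R.
    rewrite ReS; apply: (@le_trans _ _ (\sum_(J | J \notin inj) C)).
      by apply: ler_sum => J _; exact: aC.
    rewrite (eq_bigl (mem [predC inj])) // sumr_const -[leLHS]mulr_natr.
    rewrite ler_wpM2l // ler_nat.
    have -> : #|[predC inj]| = (M ^ d - M ^_ d)%N.
      by have := cardC (mem inj); rewrite card_ffun !card_ord cinj => <-; rewrite addKn.
    by rewrite leq_subLR expn_le_ffact.
  have := Fpos _ y0 y1; set F := complex.Re (\sum_(t <- s) _) in H * => Fd.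
  have : C * (d ^ 2 * M ^ d.-1)%:R <= M%:R ^+ d * F.
    apply: (@le_trans _ _ (M%:R ^+ d * delta)); last by rewrite ler_wpM2l // exprn_ge0.
    case: (posnP d) => [d0|d0]; first by rewrite {1}d0 mul0n mulr0 mulr_ge0 ?exprn_ge0 // ltW.
    have -> : C * (d ^ 2 * M ^ d.-1)%:R = M%:R ^+ d.-1 * (C * (d ^ 2)%:R).
      by rewrite natrM (natrX _ _ d.-1) mulrA mulrC.
    rewrite -[in leRHS](prednK d0) exprSr -mulrA.
    rewrite ler_wpM2l ?exprn_ge0 // -ler_pdivrMr //.
    apply: le_trans (ltW (archi_boundP _)) _.
      by rewrite divr_ge0 ?mulr_ge0 // ltW.
    by rewrite ler_nat /M addnS -addSn leq_addl.
  by move=> H1; move: bad H1; rewrite -H; lra.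
(* Every injective placement expands the same polynomial, so the average of these expansions is
   again an expansion of it. *)
have key (J : {ffun 'I_d -> 'I_M}) : J \in inj ->
  (\sum_(t <- s) t.1 *: \prod_j \sum_i t.2 j i *: Y i) * (\sum_i Y i) ^+ (M - d) =
  \sum_w a (comp w J) *: \prod_r Y (w r).
  rewrite inE => /injectiveP Jinj.
  under [RHS]eq_bigr do rewrite scaler_suml.
  rewrite exchange_big /= mulr_suml; apply: eq_bigr => t _.
  under [RHS]eq_bigr do rewrite -scalerA.
  rewrite -scaler_sumr -scalerAl; congr (_ *: _).
  rewrite -(prod_pick_inj _ _ Jinj).
  pose k (r : 'I_M) i : R[i] := if [pick j | J j == r] is Some j then t.2 j i else 1.
  transitivity (\prod_(r < M) \sum_i k r i *: Y i).
    apply: eq_bigr => r _; rewrite /k; case: pickP => // _.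
    by apply: eq_bigr => i _; rewrite scale1r.
  rewrite bigA_distr_bigA; apply: eq_bigr => w _.
  rewrite scaler_prod; congr (_ *: _).
  transitivity (\prod_j t.2 j (w (J j))); last first.
    by apply: eq_bigr => j _; rewrite ffunE.
  have := prod_pick_inj (fun j => t.2 j (w (J j))) 1 Jinj.
  rewrite expr1n mulr1 => <-; apply: eq_bigr => r _; rewrite /k.
  by case: pickP => // j /eqP ->.
transitivity ((#|inj|%:R)^-1 *: \sum_(J in inj) \sum_w a (comp w J) *: \prod_r Y (w r)).
  rewrite -(eq_bigr _ key) sumr_const -(scaler_nat #|inj| (_ * _)) scalerA.
  by rewrite mulVf ?scale1r // pnatr_eq0 -lt0n.
rewrite exchange_big scaler_sumr; apply: eq_bigr => w _ /=.
by rewrite -scaler_suml scalerA.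
Qed.
End Polya.

(** * Penalization and Tchakaloff's theorem *)

(** The part of [K] where [F <= 0] is compact and [G] is positive there, hence bounded below by some
    [g > 0]; a large multiple of [G] outweighs the minimum of [F]. *)
Lemma penalty_pos (R : realType) (T : topologicalType) (K : set T)
    (F G : T -> R) : compact K -> continuous F -> continuous G ->
  (forall z, K z -> 0 <= G z) -> (forall z, K z -> G z = 0 -> 0 < F z) ->
  exists lam delta, [/\ 0 <= lam, 0 < delta &
    forall z, K z -> delta <= F z + lam * G z].
Proof.
move=> cK cF cG G0 F0.
have posmin (H : T -> R) (K' : set T) : compact K' -> continuous H ->
    (forall z, K' z -> 0 < H z) ->
    exists2 delta, 0 < delta & forall z, K' z -> delta <= H z.
  move=> cK' cH H0; have [->|/set0P K'0] := eqVneq K' set0; first by exists 1.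
  have [c /set_mem K'c minc] := compact_EVT_min K'0 cK' (continuous_subspaceT cH).
  by exists (H c) => [|z K'z]; [exact: H0|apply: minc; rewrite inE].
have [lam lam0 pos] : exists2 lam, 0 <= lam &
    forall z, K z -> 0 < F z + lam * G z.
  have cK' : compact (K `&` [set z | F z <= 0]).
    apply: compact_closedI => //.
    by apply: (@closed_comp _ _ F [set x | x <= 0]) => [z _|]; [exact: cF|exact: closed_le].
  have G0' z : (K `&` [set z | F z <= 0]) z -> 0 < G z.
    move=> [Kz /= Fz]; rewrite lt_neqAle G0 // andbT eq_sym.
    by apply/eqP => /(F0 _ Kz); rewrite ltNge Fz.
  have [g g0 gP] := posmin G _ cK' cG G0'.
  have [->|/set0P K0] := eqVneq K set0; first by exists 0.
  have [c /set_mem Kc minc] := compact_EVT_min K0 cK (continuous_subspaceT cF).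
  exists ((`|F c| + 1) / g); first by rewrite divr_ge0 ?addr_ge0 // ltW.
  move=> z Kz; have [Fz|Fz] := ltP 0 (F z).
    by rewrite ltr_wpDr // mulr_ge0 ?G0 // divr_ge0 ?addr_ge0 // ltW.
  have h1 : `|F c| + 1 <= (`|F c| + 1) / g * G z.
    by rewrite mulrAC ler_pdivlMr // ler_wpM2l ?addr_ge0 //; exact: gP.
  have : - `|F c| <= F z.
    by apply: le_trans (minc z _); rewrite ?inE // lerNl ler_normr lexx orbT.
  by move: h1; lra.
have cH : continuous (fun z => F z + lam * G z).
  by move=> z; apply: cvgD; [exact: cF|apply: cvgM; [exact: cvg_cst|exact: cG]].
have [delta d0 dP] := posmin _ _ cK cH pos.
by exists lam, delta.
Qed.

(** [D.+1] vectors in dimension [D] satisfy a relation [mu] with a positive entry. Subtract the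
    largest multiple of [mu] that keeps the weights nonnegative: the index minimizing [w k / mu k]
    over [mu k > 0] drops out. The total weight may change. *)
Lemma caratheodory (R : realFieldType) (D : nat) (w : 'I_D.+1 -> R)
    (m : 'I_D.+1 -> 'rV[R]_D) : (forall j, 0 <= w j) ->
  exists (w' : 'I_D.+1 -> R) (k : 'I_D.+1),
    [/\ forall j, 0 <= w' j, w' k = 0 & \sum_j w' j *: m j = \sum_j w j *: m j].
Proof.
move=> w0; pose A := \matrix_(j < D.+1) m j.
have [mu mu0 muA] : exists2 mu : 'rV[R]_D.+1, mu != 0 & mu *m A = 0.
  have /rowV0Pn[mu /sub_kermxP muA mu0] : kermx A != 0.
    by rewrite -mxrank_eq0 mxrank_ker subn_eq0 -ltnNge ltnS rank_leq_col.
  by exists mu.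
have sumE (f : 'rV_D.+1) : f *m A = \sum_j f 0 j *: m j.
  by rewrite mulmx_sum_row; apply: eq_bigr => j _; rewrite rowK.
wlog [i mui] : mu mu0 muA / exists i, 0 < mu 0 i.
  move=> H; have /existsP[i mui] : [exists i, mu 0 i != 0].
    rewrite -negb_forall; apply: contra mu0 => /forallP mu00.
    by apply/eqP/rowP => j; rewrite mxE; exact/eqP/mu00.
  have [mun|mup|mu00] := ltgtP (mu 0 i) 0; last by rewrite mu00 eqxx in mui.
    apply: (H (- mu)); rewrite ?oppr_eq0 ?mulNmx ?muA ?oppr0 //.
    by exists i; rewrite mxE oppr_gt0.
  by apply: (H mu) => //; exists i.
have [k muk kmin] : exists2 k, 0 < mu 0 k &
    forall j, 0 < mu 0 j -> w k / mu 0 k <= w j / mu 0 j.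
  by case: (@arg_minP _ _ _ i (fun j => 0 < mu 0 j) (fun j => w j / mu 0 j) mui) => k; exists k.
exists (fun j => w j - w k / mu 0 k * mu 0 j), k; split.
- move=> j; rewrite subr_ge0; have [mj|mj] := ltP 0 (mu 0 j).
    by rewrite -ler_pdivlMr // kmin.
  by apply: le_trans (w0 j); rewrite mulr_ge0_le0 // divr_ge0 // ltW.
- by rewrite divfK ?subrr // gt_eqF.
- under eq_bigr do rewrite scalerBl -scalerA.
  by rewrite big_split /= sumrN -scaler_sumr -sumE muA scaler0 subr0.
Qed.

Lemma continuous_sumr (R : realType) (T : topologicalType) (I : Type) (r : seq I)
    (F : I -> T -> R) : (forall i, continuous (F i)) ->
  continuous (fun x => \sum_(i <- r) F i x).
Proof.
move=> cF; apply: continuous_big => //= x.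
by apply: cvgD; [exact: cvg_fst|exact: cvg_snd].
Qed.

Lemma continuous_mulr (R : realType) (T : topologicalType) (f g : T -> R) :
  continuous f -> continuous g -> continuous (fun x => f x * g x).
Proof. by move=> cf cg x; apply: cvgM; [exact: cf|exact: cg]. Qed.

Lemma continuous_subr (R : realType) (T : topologicalType) (f g : T -> R) :
  continuous f -> continuous g -> continuous (fun x => f x - g x).
Proof. by move=> cf cg x; apply: cvgB; [exact: cf|exact: cg]. Qed.

(** Stated for arbitrary topological entries, because the atoms below form a row whose entries are
    themselves points. *)
Lemma row_coord_continuous (T : topologicalType) (k : nat) (j : 'I_k) :
  continuous (fun v : 'rV[T]_k => v ord0 j).
Proof.
move=> v A vA; exists (fun _ l => if l == j then A else setT).
  by move=> i l; case: eqP => [->|_]; [rewrite (ord1 i)|exact: filterT].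
by move=> M /(_ ord0 j); rewrite /= eqxx.
Qed.

Section Tchakaloff.
Variables (R : realType) (m D : nat) (X : set 'rV[R]_m).
Variables (phi : 'I_D -> 'rV[R]_m -> R) (z : 'I_D -> R).
Hypothesis compactX : compact X.
Hypothesis X0 : X !=set0.
Hypothesis phi_cont : forall i, continuous (phi i).
(** Only strictly positive combinations are tested, since those are the ones the Positivstellensatz
    places in the quadratic module. *)
Hypothesis z_pos : forall (a : 'I_D -> R) b,
  (forall p, X p -> 0 < \sum_i a i * phi i p + b) -> 0 <= \sum_i a i * z i + b.

Let T : Type := ('rV[R]_D.+1 * 'rV['rV[R]_m]_D.+1)%type.

Let mass (v : T) : R := \sum_j v.1 ord0 j.
Let mom (v : T) i : R := \sum_j v.1 ord0 j * phi i (v.2 ord0 j).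
Let atoms : set T :=
  ([set w : 'rV[R]_D.+1 | forall j, `[0, 1]%classic (w ord0 j)] `*`
    [set p : 'rV['rV[R]_m]_D.+1 | forall j, X (p ord0 j)])
  `&` [set v | mass v = 1].
Let dist2 (v : T) : R := \sum_i (mom v i - z i) ^+ 2.

Let weight_cont j : continuous (fun v : T => v.1 ord0 j).
Proof.
move=> v; apply: (@cvg_comp _ _ _ fst (fun w : 'rV[R]_D.+1 => w ord0 j) _ (nbhs v.1)).
  exact: cvg_fst.
exact: (@row_coord_continuous R).
Qed.

Let atom_cont j : continuous (fun v : T => v.2 ord0 j).
Proof.
move=> v; apply: (@cvg_comp _ _ _ snd (fun p : 'rV['rV[R]_m]_D.+1 => p ord0 j) _ (nbhs v.2)).
  exact: cvg_snd.
exact: (@row_coord_continuous 'rV[R]_m).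
Qed.

Let mass_cont : continuous mass.
Proof. by apply: continuous_sumr => j; exact: (@weight_cont j). Qed.

Let mom_cont i : continuous (mom^~ i).
Proof.
apply: continuous_sumr => j; apply: continuous_mulr; first exact: (@weight_cont j).
by move=> v; apply: (cvg_comp _ _ (@atom_cont j v)); exact: phi_cont.
Qed.

Let dist2_cont : continuous dist2.
Proof.
apply: continuous_sumr => i; under eq_fun do rewrite expr2.
have c : continuous (fun v => mom v i - z i).
  by apply: continuous_subr; [exact: (@mom_cont i)|exact: cst_continuous].
exact: (continuous_mulr c c).
Qed.

Let atoms_compact : compact atoms.
Proof.
apply: compact_closedI.
  apply: compact_setX; last exact: (rV_compact (fun=> compactX)).
  exact: (rV_compact (fun=> @segment_compact R 0 1)).
by apply: (@closed_comp _ _ mass [set 1]) => [v _|]; [exact: mass_cont|exact: closed_eq].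
Qed.

Let mk (w : 'I_D.+1 -> R) (p : 'I_D.+1 -> 'rV[R]_m) : T :=
  (\row_j w j, \row_j p j).

Let atoms_mk w p : (forall j, 0 <= w j) -> \sum_j w j = 1 ->
  (forall j, X (p j)) -> atoms (mk w p).
Proof.
move=> w0 w1 Xp; split; last first.
  by rewrite /= /mass -[RHS]w1; apply: eq_bigr => j _; rewrite mxE.
split=> j /=; rewrite mxE //= in_itv /= w0 /= -w1 (bigD1 j) //= lerDl.
exact: sumr_ge0.
Qed.

Let mom_mk w p i : mom (mk w p) i = \sum_j w j * phi i (p j).
Proof. by apply: eq_bigr => j _; rewrite !mxE. Qed.

(** Adding [p] yields [D.+2] atoms. Caratheodory's lemma in dimension [1 + D], with a constant
    coordinate 1 that preserves the mass, removes one of them. *)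
Let mix v p t : atoms v -> X p -> 0 <= t <= 1 ->
  exists2 u, atoms u & forall i, mom u i = (1 - t) * mom v i + t * phi i p.
Proof.
move=> [[vA vX] v1] Xp /andP[t0 t1].
pose w (j : 'I_D.+2) := if unlift ord0 j is Some k then (1 - t) * v.1 ord0 k else t.
pose q (j : 'I_D.+2) := if unlift ord0 j is Some k then v.2 ord0 k else p.
pose M (j : 'I_D.+2) : 'rV[R]_(1 + D) := row_mx 1%:M (\row_i phi i (q j)).
have Ml j : M j 0 (lshift D 0) = 1 by rewrite row_mxEl mxE.
have Mr j i : M j 0 (rshift 1 i) = phi i (q j) by rewrite row_mxEr mxE.
have w0 j : 0 <= w j.
  rewrite /w; case: unliftP => // k _; rewrite mulr_ge0 ?subr_ge0 //.
  by have := vA k; rewrite /= in_itv /= => /andP[].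
have Xq j : X (q j) by rewrite /q; case: unliftP => // k _; exact: vX.
have [w' [k [w'0 w'k w'E]]] := caratheodory M w0.
have w'1 : \sum_j w' j = \sum_j w j.
  have /(congr1 (fun x : 'rV_(1 + D) => x 0 (lshift D 0))) := w'E.
  rewrite !summxE => H.
  transitivity (\sum_j (w' j *: M j) 0 (lshift D 0)).
    by apply: eq_bigr => j _; rewrite mxE Ml mulr1.
  by rewrite H; apply: eq_bigr => j _; rewrite mxE Ml mulr1.
have w'phi i : \sum_j w' j * phi i (q j) = \sum_j w j * phi i (q j).
  have /(congr1 (fun x : 'rV_(1 + D) => x 0 (rshift 1 i))) := w'E.
  rewrite !summxE => H.
  transitivity (\sum_j (w' j *: M j) 0 (rshift 1 i)).
    by apply: eq_bigr => j _; rewrite mxE Mr.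
  by rewrite H; apply: eq_bigr => j _; rewrite mxE Mr.
have drop (f : 'I_D.+2 -> R) :
    \sum_j w' (lift k j) * f (lift k j) = \sum_j w' j * f j.
  by rewrite [RHS](bigD1_ord k) //= w'k mul0r add0r.
exists (mk (fun j => w' (lift k j)) (fun j => q (lift k j))).
  apply: atoms_mk => //; have := drop (fun=> 1).
  under eq_bigr do rewrite mulr1; move=> ->.
  under eq_bigr do rewrite mulr1; rewrite w'1.
  rewrite big_ord_recl /w unlift_none; under eq_bigr do rewrite liftK.
  by rewrite -mulr_sumr -/(mass v) v1 mulr1 addrC subrK.
move=> i; rewrite mom_mk (drop (fun j => phi i (q j))) w'phi.
rewrite big_ord_recl /w /q unlift_none addrC; congr (_ + _).
by rewrite mulr_sumr; apply: eq_bigr => j _; rewrite liftK mulrA.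
Qed.

(* Minimize the squared distance from the moments of [D.+1] weighted atoms to [z];
   Caratheodory's theorem lets a minimizer be mixed with a further atom, so a nonzero
   residual would be a separating functional excluded by [z_pos]. *)
Lemma tchakaloff : exists (w : 'I_D.+1 -> R) (p : 'I_D.+1 -> 'rV[R]_m),
  [/\ forall j, 0 <= w j, \sum_j w j = 1, forall j, X (p j) &
      forall i, \sum_j w j * phi i (p j) = z i].
Proof.
have A0 : atoms !=set0.
  have [x Xx] := X0; exists (mk (fun j => (j == ord0)%:R) (fun=> x)).
  apply: atoms_mk => //; rewrite (bigD1 ord0) //= big1 ?addr0 // => j.
  by move=> /negPf ->.
have [v /set_mem Av vmin] := compact_EVT_min A0 atoms_compact (continuous_subspaceT dist2_cont).
have [[vA vX] v1] := Av.
suff v0 : dist2 v = 0.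
  exists (fun j => v.1 ord0 j), (fun j => v.2 ord0 j); split => //.
  - by move=> j; have := vA j; rewrite /= in_itv /= => /andP[].
  - move=> i; move/eqP: v0; rewrite psumr_eq0; last by move=> *; exact: sqr_ge0.
    by move=> /allP/(_ i (mem_index_enum _)); rewrite sqrf_eq0 subr_eq0 => /eqP.
pose a i := mom v i - z i.
have obtuse p : X p -> 0 <= \sum_i a i * (phi i p - mom v i).
  move=> Xp; set c := \sum_i _; rewrite leNgt; apply/negP => c0.
  pose B := \sum_i (phi i p - mom v i) ^+ 2.
  have B0 : 0 <= B by apply: sumr_ge0 => i _; exact: sqr_ge0.
  (* Moving by [t] towards [p] changes the squared distance by [t (2 c + t B)]. This [t] lies in
     [(0, 1]] even when [B = 0], and gives [t B < - c], so the distance would decrease. *)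
  pose t := - c / (B - c).
  have Bc : 0 < B - c by rewrite subr_gt0 (lt_le_trans c0).
  have t01 : 0 <= t <= 1.
    by rewrite divr_ge0 ?oppr_ge0 ?(ltW c0) ?(ltW Bc) //= ler_pdivrMr // mul1r lerDr.
  have t0 : 0 < t by rewrite divr_gt0 // oppr_gt0.
  have [u Au uE] := mix Av Xp t01.
  have := vmin u; rewrite inE => /(_ Au).
  have -> : dist2 u = dist2 v + (2 * t * c + t ^+ 2 * B).
    rewrite /dist2 !mulr_sumr -!big_split /=; apply: eq_bigr => i _.
    by rewrite uE /a; ring.
  have -> : 2 * t * c + t ^+ 2 * B = t * (2 * c + t * B) by ring.
  rewrite lerDl pmulr_rge0 //.
  have tB : t * B < - c.
    rewrite /t mulrAC ltr_pdivrMr // ltr_pM2l ?oppr_gt0 //; lra.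
  lra.
apply/eqP; rewrite eq_le sumr_ge0 ?andbT; last by move=> i _; exact: sqr_ge0.
rewrite leNgt; apply/negP => d0.
have dE : dist2 v = \sum_i a i * a i by apply: eq_bigr => i _; rewrite expr2.
(* The hyperplane orthogonal to the residual, placed halfway between [z] and the minimizer: by
   [obtuse] the expression is at least [dist2 v / 2] on [X], whereas at [z] it equals
   [- dist2 v / 2]. *)
have /z_pos : forall p, X p ->
    0 < \sum_i a i * phi i p + (- \sum_i a i * z i - dist2 v / 2).
  move=> p /obtuse h.
  have : \sum_i a i * phi i p - \sum_i a i * z i =
      \sum_i a i * (phi i p - mom v i) + dist2 v.
    by rewrite dE -sumrB -big_split /=; apply: eq_bigr => i _; rewrite /a; ring.
  lra.
lra.
Qed.

End Tchakaloff.

(** * Conjugation, evaluation and quadratic modules *)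

Lemma split_lshift m k (i : 'I_m) : fintype.split (lshift k i) = inl i.
Proof. exact: (unsplitK (inl i)). Qed.
Lemma split_rshift m k (i : 'I_k) : fintype.split (rshift m i) = inr i.
Proof. exact: (unsplitK (inr i)). Qed.

(* [pbar], [ev] and [nrm2] are locked: unification would otherwise unfold them into
   sums over monomials when comparing distinct polynomials. *)
HB.lock Definition pbar (R : realType) (n : nat) (p : cpoly R n) : cpoly R n :=
  pconj p.

Section Cpoly.
Variables (R : realType) (n : nat).
Notation C := R[i].
Notation N := (n + n + (n + n))%N.
Implicit Types (p q : cpoly R n) (k : 'I_N).

Lemma swap_halfK : involutive (@swap_half n).
Proof.
by move=> k; rewrite /swap_half; case: (split_ordP k) => i -> /=;
  rewrite ?(split_lshift, split_rshift).
Qed.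

Lemma swap_conjK : involutive (@swap_conj n).
Proof.
by move=> k; rewrite /swap_conj; case: (split_ordP k) => i -> /=;
  rewrite ?(split_lshift, split_rshift) swap_halfK.
Qed.

(** The index is an upper bound of the degree, hence the clause passing from [d] to [d.+1] with the
    same [p]. Carrying it along lets [lifted_deg] produce forms of a prescribed degree. *)
Lemma mpoly_graded_ind (P : nat -> cpoly R n -> Prop) :
  (forall d, P d 0) ->
  (forall d c p q, P d p -> P d q -> P d (c *: p + q)) ->
  P 0 1 -> (forall d p, P d p -> P d.+1 p) ->
  (forall d k p, P d p -> P d.+1 (Xpoly R k * p)) ->
  forall d p, deg_le d p -> P d p.
Proof.
move=> P0 Plin P1 PS PX d p dp.
have Pm m : (mdeg m <= d)%N -> P d (mpolyX C m).
  elim: d m {p dp} => [|d IH] m.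
    by rewrite leqn0 mdeg_eq0 => /eqP ->; rewrite mpolyX0.
  rewrite leq_eqVlt => /orP[/eqP md|]; last by move=> /IH; exact: PS.
  have [k mk] : exists k, m k != 0%N.
    apply/existsP; rewrite -negb_forall; apply: contraPN md => /forallP m0.
    by rewrite mdegE big1 // => k _; exact/eqP.
  have -> : m = mnm_add (mnm1 k) (mnm_sub m (mnm1 k)).
    by rewrite addmC submK // lep1mP.
  rewrite mpolyXD; apply: PX; apply: IH.
  have : mdeg m = mdeg (mnm_add (mnm_sub m (mnm1 k)) (mnm1 k)) by rewrite submK // lep1mP.
  by rewrite md mdegD mdeg1 addn1 => -[->].
rewrite (mpolyE p); move: dp; rewrite /deg_le /= => dp.
have : forall m, m \in msupp p -> P d (mpolyX C m).
  move=> m mp; apply: Pm; rewrite -ltnS; apply: (leq_trans _ dp).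
  exact: msize_mdeg_lt.
elim: (msupp p) => [|m s IH] h; first by rewrite big_nil; exact: P0.
rewrite big_cons; apply: Plin; first by apply: h; rewrite mem_head.
by apply: IH => m' m's; apply: h; rewrite inE m's orbT.
Qed.

Lemma deg_le0 d : deg_le d (0 : cpoly R n).
Proof. by rewrite /deg_le /= mmeasure0. Qed.

Lemma deg_leD d p q : deg_le d p -> deg_le d q -> deg_le d (p + q).
Proof.
rewrite /deg_le /= => dp dq; apply: leq_trans (mmeasureD_le _ _ _) _.
by rewrite geq_max dp.
Qed.

Lemma deg_leZ d c p : deg_le d p -> deg_le d (c *: p).
Proof. by rewrite /deg_le /= => dp; apply: leq_trans (mmeasureZ_le _ _ _) dp. Qed.

Lemma deg_leN d p : deg_le d p -> deg_le d (- p).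
Proof. by rewrite /deg_le /= mmeasureN. Qed.

Lemma deg_leB d p q : deg_le d p -> deg_le d q -> deg_le d (p - q).
Proof. by move=> dp dq; apply: deg_leD => //; exact: deg_leN. Qed.

Lemma deg_le_sum d (I : Type) (s : seq I) (P : pred I) (F : I -> cpoly R n) :
  (forall i, P i -> deg_le d (F i)) -> deg_le d (\sum_(i <- s | P i) F i).
Proof.
move=> h; elim/big_ind: _ => //; first exact: deg_le0.
by move=> p q; exact: deg_leD.
Qed.

Lemma deg_leW d e p : (d <= e)%N -> deg_le d p -> deg_le e p.
Proof. by rewrite /deg_le /= => de dp; apply: leq_trans dp _. Qed.

Lemma deg_leM d e p q : deg_le d p -> deg_le e q -> deg_le (d + e) (p * q).
Proof.
rewrite /deg_le /= => dp dq; have [->|p0] := eqVneq p 0; first by rewrite mul0r mmeasure0.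
have [->|q0] := eqVneq q 0; first by rewrite mulr0 mmeasure0.
rewrite msizeM // -addSn; apply: leq_trans (_ : (d.+1 + e.+1).-1 <= _)%N.
  by rewrite -!subn1 leq_sub2r // leq_add.
by rewrite addnS.
Qed.

Lemma deg_leX k : deg_le 1 (Xpoly R k).
Proof. by rewrite /deg_le /= [X in (X <= _)%N]msizeX mdeg1. Qed.

Lemma deg_le1 d : deg_le d (1 : cpoly R n).
Proof. by rewrite /deg_le /= mmeasureC; case: (_ != _). Qed.

Lemma deg_le_mpolyX m : deg_le (mdeg m) (mpolyX C m : cpoly R n).
Proof. by rewrite /deg_le /= [X in (X <= _)%N]msizeX. Qed.

Lemma deg_le_exists p : exists d, deg_le d p.
Proof. by exists (mmeasure (@mdeg _) p); rewrite /deg_le /=. Qed.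

Lemma pbarE p : pconj p = pbar p.
Proof. by rewrite unlock. Qed.

Fact pbar_zmod_morphism : zmod_morphism (@pbar R n).
Proof. by move=> p q; rewrite !unlock; exact: mmapB. Qed.

Fact pbar_monoid_morphism : monoid_morphism (@pbar R n).
Proof.
split=> [|p q]; rewrite !unlock; first exact: (rmorph1 (mmap (@mpolyC _ _ \o Num.conj) _)).
exact: (rmorphM (mmap (@mpolyC _ _ \o Num.conj) _)).
Qed.

HB.instance Definition _ :=
  GRing.isZmodMorphism.Build _ _ (@pbar R n) pbar_zmod_morphism.
HB.instance Definition _ :=
  GRing.isMonoidMorphism.Build _ _ (@pbar R n) pbar_monoid_morphism.

Lemma pbarD p q : pbar (p + q) = pbar p + pbar q.
Proof. exact: rmorphD. Qed.

Lemma pbarB p q : pbar (p - q) = pbar p - pbar q.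
Proof. exact: rmorphB. Qed.

Lemma pbarM p q : pbar (p * q) = pbar p * pbar q.
Proof. exact: rmorphM. Qed.

Lemma pbar0 : pbar (0 : cpoly R n) = 0.
Proof. exact: rmorph0. Qed.

Lemma pbar1 : pbar (1 : cpoly R n) = 1.
Proof. exact: rmorph1. Qed.

Lemma pbar_sum (I : Type) (r : seq I) (P : pred I) (F : I -> cpoly R n) :
  pbar (\sum_(i <- r | P i) F i) = \sum_(i <- r | P i) pbar (F i).
Proof. exact: rmorph_sum. Qed.

Lemma pbarX k : pbar (Xpoly R k) = Xpoly R (swap_conj k).
Proof. by rewrite unlock /pconj /Xpoly mmapX mmap1U. Qed.

Lemma pbarC c : pbar (mpolyC N c) = mpolyC N c^* :> cpoly R n.
Proof. by rewrite unlock /pconj mmapC. Qed.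

Lemma pbarZ c p : pbar (c *: p) = c^* *: pbar p.
Proof. by rewrite -mul_mpolyC pbarM pbarC mul_mpolyC. Qed.

Lemma pbar_lin c p q : pbar (c *: p + q) = c^* *: pbar p + pbar q.
Proof. by rewrite pbarD pbarZ. Qed.

Lemma deg_le_pbar d p : deg_le d p -> deg_le d (pbar p).
Proof.
apply: (@mpoly_graded_ind (fun d p => deg_le d (pbar p))) => {d p}.
- by move=> d; rewrite pbar0; exact: deg_le0.
- by move=> d c p q dp dq; rewrite pbar_lin; apply/deg_leD/dq/deg_leZ.
- by rewrite pbar1; exact: deg_le1.
- by move=> d p; exact: deg_leW.
- by move=> d k p dp; rewrite pbarM pbarX; apply/(@deg_leM 1)/dp/deg_leX.
Qed.

Lemma mpoly_ring_ind (P : cpoly R n -> Prop) :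
  (forall c p q, P p -> P q -> P (c *: p + q)) -> P 1 ->
  (forall k p, P p -> P (Xpoly R k * p)) -> forall p, P p.
Proof.
move=> Plin P1 PX p; have [d dp] := deg_le_exists p.
apply: (@mpoly_graded_ind (fun _ => P)) dp => //.
by move=> _; have := Plin (-1) 1 1 P1 P1; rewrite scaleN1r addNr.
Qed.

Lemma pbarK : involutive (@pbar R n).
Proof.
elim/mpoly_ring_ind => [c p q hp hq||k p hp].
- by rewrite !pbar_lin conjCK hp hq.
- by rewrite !pbar1.
- by rewrite !pbarM hp !pbarX swap_conjK.
Qed.

Definition env (u v : 'cV[C]_n) k : C :=
  match fintype.split k with
  | inl j => match fintype.split j with inl i => u i ord0 | inr i => (u i ord0)^* end
  | inr j => match fintype.split j with inl i => v i ord0 | inr i => (v i ord0)^* end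
  end.

Lemma env_swap u v k : env u v (swap_conj k) = (env u v k)^*.
Proof.
by rewrite /env /swap_conj /swap_half; case: (split_ordP k) => j _ /=;
  rewrite ?(split_lshift, split_rshift); case: (split_ordP j) => i _ /=;
  rewrite ?(split_lshift, split_rshift) ?conjCK.
Qed.

End Cpoly.

HB.lock Definition ev (R : realType) (n : nat) (u v : 'cV[R[i]]_n) (p : cpoly R n) :
  R[i] := meval (env u v) p.

Section Evaluation.
Variables (R : realType) (n : nat) (u v : 'cV[R[i]]_n).
Implicit Types (p q : cpoly R n).

Fact ev_zmod_morphism : zmod_morphism (ev u v).
Proof. by move=> p q; rewrite !unlock; exact: mmapB. Qed.

Fact ev_monoid_morphism : monoid_morphism (ev u v).
Proof. by split=> [|p q]; rewrite !unlock; [exact: meval1|exact: mevalM]. Qed.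

HB.instance Definition _ := GRing.isZmodMorphism.Build _ _ (ev u v) ev_zmod_morphism.
HB.instance Definition _ := GRing.isMonoidMorphism.Build _ _ (ev u v) ev_monoid_morphism.

Lemma evD p q : ev u v (p + q) = ev u v p + ev u v q.
Proof. exact: rmorphD. Qed.

Lemma evB p q : ev u v (p - q) = ev u v p - ev u v q.
Proof. exact: rmorphB. Qed.

Lemma evM p q : ev u v (p * q) = ev u v p * ev u v q.
Proof. exact: rmorphM. Qed.

Lemma ev1 : ev u v 1 = 1.
Proof. exact: rmorph1. Qed.

Lemma ev_sum (I : Type) (r : seq I) (P : pred I) (F : I -> cpoly R n) :
  ev u v (\sum_(i <- r | P i) F i) = \sum_(i <- r | P i) ev u v (F i).
Proof. exact: rmorph_sum. Qed.

Lemma evZ c p : ev u v (c *: p) = c * ev u v p.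
Proof. by rewrite !unlock; exact: mevalZ. Qed.

Lemma evX k : ev u v (Xpoly R k) = env u v k.
Proof. by rewrite unlock; exact: mevalXU. Qed.

Lemma ev_bar p : ev u v (pbar p) = (ev u v p)^*.
Proof.
elim/mpoly_ring_ind: p => [c p q hp hq||k p hp].
- by rewrite pbar_lin !evD !evZ hp hq rmorphD rmorphM.
- by rewrite pbar1 ev1 rmorph1.
- by rewrite pbarM pbarX !evM !evX env_swap hp rmorphM.
Qed.

End Evaluation.

HB.lock Definition nrm2 (R : realType) (n : nat) (b : bool) : cpoly R n :=
  sqnorm (if b then xvec R n else yvec R n).

(** * Sums of Hermitian squares, quadratic modules and their order unit *)

Section Qmod.
Variables (R : realType) (n : nat).
Notation C := R[i].
Notation N := (n + n + (n + n))%N.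
Implicit Types (p q s a : cpoly R n) (k : 'I_N) (D : set (cpoly R n)).

Lemma conj_realC (r : R) : (r%:C)^* = r%:C.
Proof. by apply: conj_Creal; apply/complex_realP; exists r. Qed.

Lemma realC_ge0 (r : R) : (0 <= r%:C :> C) = (0 <= r).
Proof. exact: ler0c. Qed.

Notation nrm2 := (nrm2 R n).

Definition pRe p : cpoly R n := 2^-1 *: (p + pbar p).
Definition pIm p : cpoly R n := pRe (- 'i *: p).

Lemma pRe_herm p : pbar (pRe p) = pRe p.
Proof. by rewrite /pRe pbarZ pbarD pbarK addrC fmorphV rmorph_nat. Qed.

Lemma pRe_id p : pbar p = p -> pRe p = p.
Proof.
move=> ph; rewrite /pRe ph -mulr2n -(scaler_nat 2 p) scalerA.
by rewrite mulVf ?scale1r // pnatr_eq0.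
Qed.

Lemma pReB p q : pRe (p - q) = pRe p - pRe q.
Proof. by rewrite /pRe pbarB -scalerBr addrACA opprD. Qed.

Lemma pReD p q : pRe (p + q) = pRe p + pRe q.
Proof. by rewrite /pRe pbarD -scalerDr addrACA. Qed.

Lemma pReZ (r : R) p : pRe (r%:C *: p) = r%:C *: pRe p.
Proof. by rewrite /pRe pbarZ conj_realC -scalerDr !scalerA mulrC. Qed.

Lemma pReM_herm p q : pbar q = q -> pRe (p * q) = pRe p * q.
Proof. by move=> qh; rewrite /pRe pbarM qh -mulrDl scalerAl. Qed.

Lemma pRe_pIm p : p = pRe p + 'i *: pIm p.
Proof.
have cNi : (- 'i)^* = 'i :> C by rewrite rmorphN /= conjCi opprK.
by rewrite {1}(scale_half_rect p (pbar p)) /pIm /pRe pbarZ cNi.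
Qed.

Notation sohs := (@sum_herm_squares R n).

Lemma sohsE s : sohs s <-> exists ps, s = \sum_(p <- ps) pbar p * p.
Proof.
by split=> -[ps ->]; exists ps; apply: eq_bigr => p _; rewrite pbarE.
Qed.

Lemma sohs_square p : sohs (pbar p * p).
Proof. by apply/sohsE; exists [:: p]; rewrite big_seq1. Qed.

Lemma sohs0 : sohs 0.
Proof. by exists [::]; rewrite big_nil. Qed.

Lemma sohs1 : sohs 1.
Proof. by have := sohs_square 1; rewrite pbar1 mulr1. Qed.

Lemma sohsD s s' : sohs s -> sohs s' -> sohs (s + s').
Proof.
move=> /sohsE[ps ->] /sohsE[qs ->]; apply/sohsE.
by exists (ps ++ qs); rewrite big_cat.
Qed.

Lemma sohs_sum (I : Type) (r : seq I) (P : pred I) (F : I -> cpoly R n) :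
  (forall i, P i -> sohs (F i)) -> sohs (\sum_(i <- r | P i) F i).
Proof.
move=> h; elim/big_ind: _ => //; first exact: sohs0.
by move=> p q; exact: sohsD.
Qed.

Lemma sohs_squareM a s : sohs s -> sohs (pbar a * a * s).
Proof.
move=> /sohsE[ps ->]; apply/sohsE; exists [seq a * p | p <- ps]; rewrite big_map mulr_sumr.
by apply: eq_bigr => p _; rewrite pbarM mulrACA.
Qed.

Lemma sohsM s s' : sohs s -> sohs s' -> sohs (s * s').
Proof.
move=> /sohsE[ps ->] s'P; rewrite mulr_suml.
by apply: sohs_sum => p _; exact: sohs_squareM.
Qed.

Lemma sohsZ (r : R) s : 0 <= r -> sohs s -> sohs (r%:C *: s).
Proof.
move=> r0 sP; rewrite -mul_mpolyC; apply: sohsM => //.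
have -> : mpolyC N r%:C = pbar (mpolyC N (Num.sqrt r)%:C) * mpolyC N (Num.sqrt r)%:C :> cpoly R n.
  by rewrite pbarC conj_realC -rmorphM /= -rmorphM /= -expr2 sqr_sqrtr.
exact: sohs_square.
Qed.

Lemma sohs_herm s : sohs s -> pbar s = s.
Proof.
move=> /sohsE[ps ->]; rewrite pbar_sum; apply: eq_bigr => p _.
by rewrite pbarM pbarK mulrC.
Qed.

Notation gens := (sphere_gens R n).

(* [qmodule_trunc k] is [qmod (deg_le k)]. *)
Definition qmod D : set (cpoly R n) :=
  [set q | exists2 s : 'I_5 -> cpoly R n,
     forall j, sohs (s j) /\ D (s j * tnth gens j)
   & q = \sum_(j < 5) s j * tnth gens j].

Lemma qmoduleE : @qmodule R n = qmod setT.
Proof.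
apply/seteqP; split=> q [s sP ->].
  by exists s.
by exists s => // j; have [] := sP j.
Qed.

Lemma qmod_sub D D' : D `<=` D' -> qmod D `<=` qmod D'.
Proof. by move=> DD' q [s sP ->]; exists s => // j; have [? /DD'] := sP j. Qed.

Lemma sqnorm_herm (x : 'cV[cpoly R n]_n) : pbar (sqnorm x) = sqnorm x.
Proof.
rewrite /sqnorm pbar_sum; apply: eq_bigr => i _.
by rewrite pbarE pbarM pbarK mulrC.
Qed.

Lemma gens_herm j : pbar (tnth gens j) = tnth gens j.
Proof.
case: j => [[|[|[|[|[|//]]]]] j]; rewrite /tnth /= ?pbar1 //;
by rewrite pbarB pbar1 sqnorm_herm.
Qed.

Lemma qmod_herm D q : qmod D q -> pbar q = q.
Proof.
move=> [s sP ->]; rewrite pbar_sum; apply: eq_bigr => j _.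
by rewrite pbarM gens_herm sohs_herm //; have [] := sP j.
Qed.

Definition real_subspace D := [/\ D 0, forall p q, D p -> D q -> D (p + q)
  & forall (r : R) p, D p -> D (r%:C *: p)].

Lemma real_subspace_deg_le d : real_subspace (deg_le d).
Proof.
split; [exact: deg_le0|by move=> p q; exact: deg_leD|by move=> r p; exact: deg_leZ].
Qed.

Lemma qmodD D p q : real_subspace D -> qmod D p -> qmod D q -> qmod D (p + q).
Proof.
move=> [_ DD _] [s sP ->] [s' s'P ->]; exists (fun j => s j + s' j) => [j|].
  have [[h1 h2] [h3 h4]] := (sP j, s'P j).
  by split; [exact: sohsD|rewrite mulrDl; exact: DD].
by rewrite -big_split; apply: eq_bigr => j _; rewrite mulrDl.
Qed.

Lemma qmodZ D (r : R) p : real_subspace D -> 0 <= r -> qmod D p -> qmod D (r%:C *: p).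
Proof.
move=> [_ _ DZ] r0 [s sP ->]; exists (fun j => r%:C *: s j) => [j|].
  have [h1 h2] := sP j.
  by split; [exact: sohsZ|rewrite -scalerAl; exact: DZ].
by rewrite scaler_sumr; apply: eq_bigr => j _; rewrite scalerAl.
Qed.

Lemma qmod_gen D s j : real_subspace D -> sohs s -> D (s * tnth gens j) ->
  qmod D (s * tnth gens j).
Proof.
move=> [D0 _ _] sP Ds; exists (fun i => if i == j then s else 0) => [i|].
  by case: eqP => [->//|_]; rewrite mul0r; split => //; exact: sohs0.
by rewrite (bigD1 j) //= eqxx big1 ?addr0 // => i /negPf ->; rewrite mul0r.
Qed.

Lemma qmod_sub_dom D : real_subspace D -> qmod D `<=` D.
Proof.
move=> [D0 DD _] q [s sP ->]; elim/big_ind: _ => // j _.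
by have [] := sP j.
Qed.

Lemma qmod_sohs D s : real_subspace D -> sohs s -> D s -> qmod D s.
Proof.
move=> cD sP Ds; have := @qmod_gen D s ord0 cD sP.
by rewrite /tnth /= mulr1; exact.
Qed.

Lemma qmod0 D : real_subspace D -> qmod D 0.
Proof. by move=> cD; apply: qmod_sohs => //; [exact: sohs0|case: cD]. Qed.

Lemma qmod_sum D (I : Type) (r : seq I) (P : pred I) (F : I -> cpoly R n) :
  real_subspace D -> (forall i, P i -> qmod D (F i)) -> qmod D (\sum_(i <- r | P i) F i).
Proof.
move=> cD h; elim/big_ind: _ => //; first exact: qmod0.
by move=> p q; exact: qmodD.
Qed.

Lemma nrm2_herm b : pbar (nrm2 b) = nrm2 b.
Proof. by rewrite nrm2.unlock; exact: sqnorm_herm. Qed.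

Lemma qmod_nrm2 D b s : real_subspace D -> sohs s -> D (s * (1 - nrm2 b)) ->
  qmod D (s * (1 - nrm2 b)).
Proof.
move=> cD sP Ds.
have [j gj] : exists j, tnth gens j = 1 - nrm2 b.
  by rewrite nrm2.unlock; case: b {Ds}; [exists (@Ordinal 5 1 isT)|exists (@Ordinal 5 3 isT)].
by rewrite -gj; apply: qmod_gen => //; rewrite gj.
Qed.

Lemma qmod_nrm2N D b s : real_subspace D -> sohs s -> D (s * (nrm2 b - 1)) ->
  qmod D (s * (nrm2 b - 1)).
Proof.
move=> cD sP Ds.
have [j gj] : exists j, tnth gens j = nrm2 b - 1.
  by rewrite nrm2.unlock; case: b {Ds}; [exists (@Ordinal 5 2 isT)|exists (@Ordinal 5 4 isT)].
by rewrite -gj; apply: qmod_gen => //; rewrite gj.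
Qed.

(* [4 p = |p + 1|^2 - |p - 1|^2] for Hermitian [p]. *)
Lemma qmodT_ideal b p : pbar p = p -> qmod setT (p * (nrm2 b - 1)).
Proof.
move=> ph.
have -> : p * (nrm2 b - 1) = (4^-1)%:C *: ((pbar (p + 1) * (p + 1)) * (nrm2 b - 1))
    + (4^-1)%:C *: ((pbar (p - 1) * (p - 1)) * (1 - nrm2 b)).
  rewrite -scalerDr pbarD pbarB pbar1 ph.
  have -> : (p + 1) * (p + 1) * (nrm2 b - 1) + (p - 1) * (p - 1) * (1 - nrm2 b) =
    (4 : C) *: (p * (nrm2 b - 1)) by rewrite scaler_nat; ring.
  by rewrite scalerA fmorphV rmorph_nat mulVf ?scale1r // pnatr_eq0.
have r4 : 0 <= 4^-1 :> R by rewrite invr_ge0 ler0n.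
apply: qmodD => //; apply: qmodZ => //.
  by apply: qmod_nrm2N => //; exact: sohs_square.
by apply: qmod_nrm2 => //; exact: sohs_square.
Qed.

Definition in_xblock k : bool := if fintype.split k is inl _ then true else false.

(** Gives [1 - |X_k|^2] as a sum of squares plus a generator, with the degree bound needed inside
    the truncated module. A conjugate variable has the same modulus as its partner. *)
Lemma nrm2_split k : exists2 s, sohs s /\
    deg_le 2 s & nrm2 (in_xblock k) = pbar (Xpoly R k) * Xpoly R k + s.
Proof.
have main b (i : 'I_n) : exists2 s, sohs s /\ deg_le 2 s &
    nrm2 b = (if b then xvec R n else yvec R n) i ord0 *
      pbar ((if b then xvec R n else yvec R n) i ord0) + s.
  rewrite nrm2.unlock /sqnorm (eq_bigr _ (fun j _ => congr1 _ (pbarE _))).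
  rewrite (bigD1 i) //=; set x := if b then _ else _.
  exists (\sum_(j | j != i) x j ord0 * pbar (x j ord0)) => //; split.
    by apply: sohs_sum => j _; rewrite mulrC; exact: sohs_square.
  apply: deg_le_sum => j _; rewrite ?pbarE; apply: (@deg_leM _ _ 1 1); last apply: deg_le_pbar;
  by rewrite {}/x; case: b; rewrite mxE; exact: deg_leX.
rewrite /in_xblock; case: (split_ordP k) => j -> /=; case: (split_ordP j) => i ->.
- by have [s sP ->] := main true i; exists s => //; rewrite mxE mulrC.
- have [s sP ->] := main true i; exists s => //; rewrite mxE pbarX /swap_conj.
  rewrite split_lshift /swap_half split_lshift pbarX /swap_conj.
  by rewrite split_lshift /swap_half split_rshift.
- by have [s sP ->] := main false i; exists s => //; rewrite mxE mulrC.
- have [s sP ->] := main false i; exists s => //; rewrite mxE pbarX /swap_conj.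
  rewrite split_rshift /swap_half split_lshift pbarX /swap_conj.
  by rewrite split_rshift /swap_half split_rshift.
Qed.

Lemma deg_nrm2 b : deg_le 2 (nrm2 b).
Proof.
rewrite nrm2.unlock; apply: deg_le_sum => j _; rewrite pbarE.
apply: (@deg_leM _ _ 1 1); last apply: deg_le_pbar;
by case: b; rewrite mxE; exact: deg_leX.
Qed.

(** Peel off one variable [x]: [1 - |a x|^2 = (1 - |a|^2) + |a|^2 (1 - |x|^2)]. The second term
    raises the degree by 2, exactly what passing from [t] to [t.+1] allows. *)
Lemma qmod_mon_bound t (m : multinom N) : (mdeg m <= t)%N ->
  qmod (deg_le (2 * t)) (1 - pbar (mpolyX C m) * mpolyX C m).
Proof.
elim: t m => [|t IH] m.
  rewrite leqn0 mdeg_eq0 => /eqP ->; rewrite mpolyX0 pbar1 mulr1 subrr.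
  exact/qmod0/real_subspace_deg_le.
have cD := real_subspace_deg_le (2 * t.+1).
have sub : @deg_le R n (2 * t) `<=` deg_le (2 * t.+1).
  by move=> p dp; apply: (deg_leW _ dp); rewrite leq_mul2l leqnSn orbT.
rewrite leq_eqVlt => /orP[/eqP md|/IH]; last exact: qmod_sub.
have [k mk] : exists k, m k != 0%N.
  apply/existsP; rewrite -negb_forall; apply: contraPN md => /forallP m0.
  by rewrite mdegE big1 // => k _; exact/eqP.
have mE : m = mnm_add (mnm_sub m (mnm1 k)) (mnm1 k) by rewrite submK // lep1mP.
set m' := mnm_sub m (mnm1 k) in mE.
have md' : mdeg m' = t.
  by have := md; rewrite mE mdegD mdeg1 addn1 => -[].
rewrite mE mpolyXD -/(Xpoly R k); set a := mpolyX C m'; set x := Xpoly R k.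
have da : deg_le t a by rewrite -md'; exact: deg_le_mpolyX.
have daa : deg_le (2 * t) (pbar a * a).
  by rewrite mul2n -addnn; apply: deg_leM => //; exact: deg_le_pbar.
have [s [sP ds] sE] := nrm2_split k.
have -> : 1 - pbar (a * x) * (a * x) = (1 - pbar a * a) + (pbar a * a * s +
    pbar a * a * (1 - nrm2 (in_xblock k))) by rewrite sE pbarM -/x; ring.
apply: qmodD => //; first by apply: (qmod_sub sub); apply: IH; rewrite md'.
have ds2 s' : deg_le 2 s' -> deg_le (2 * t.+1) (pbar a * a * s').
  by rewrite mulnS addnC; exact: deg_leM.
apply: qmodD => //.
  by apply: qmod_sohs => //; [exact: sohs_squareM|exact: ds2].
apply: qmod_nrm2 => //; [exact: sohs_square|apply: ds2].
by apply: deg_leB; [exact: deg_le1|exact: deg_nrm2].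
Qed.

(** Used with [u = t]: both factors of a monomial of degree at most [2 t] can be squared without
    leaving that degree. *)
Lemma multinom_split (m : multinom N) (t u : nat) : (mdeg m <= t + u)%N ->
  exists m1 m2, [/\ m = mnm_add m1 m2, (mdeg m1 <= t)%N & (mdeg m2 <= u)%N].
Proof.
elim: t m => [|t IH] m mt.
  by exists (@mnm0 N), m; split=> //; [rewrite add0m|rewrite mdeg0].
have [mu|um] := leqP (mdeg m) u.
  by exists (@mnm0 N), m; split=> //; [rewrite add0m|rewrite mdeg0].
have [k mk] : exists k, m k != 0%N.
  apply/existsP; rewrite -negb_forall; apply: contraPN um => /forallP m0.
  by rewrite mdegE big1 // => k _; exact/eqP.
have mE : m = mnm_add (mnm_sub m (mnm1 k)) (mnm1 k) by rewrite submK // lep1mP.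
set m' := mnm_sub m (mnm1 k) in mE.
have [|m1 [m2 [m'E d1 d2]]] := IH m'.
  by have := mt; rewrite mE mdegD mdeg1 addn1 addSn ltnS.
exists (mnm_add m1 (mnm1 k)), m2; split => //.
  by rewrite mE m'E -!addmA (addmC m2).
by rewrite mdegD mdeg1 addn1.
Qed.

(* For monomials [a] and [b], [2 Re (a b) = |pbar a + b|^2 - |a|^2 - |b|^2]. *)
Lemma qmod_order_unit t p : pbar p = p -> deg_le (2 * t) p ->
  exists r : R, qmod (deg_le (2 * t)) (r%:C *: 1 + p).
Proof.
move=> ph dp; have cD := real_subspace_deg_le (2 * t).
have mono c (m : multinom N) : (mdeg m <= 2 * t)%N ->
    exists r : R, qmod (deg_le (2 * t)) (r%:C *: 1 + pRe (c *: mpolyX C m)).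
  rewrite mul2n -addnn => /multinom_split[m1 [m2 [-> d1 d2]]]; rewrite mpolyXD.
  pose a := c *: mpolyX C m1 : cpoly R n; pose b := mpolyX C m2 : cpoly R n.
  pose r : R := (complex.Re c) ^+ 2 + (complex.Im c) ^+ 2.
  have rE : r%:C = c^* * c :> C by rewrite /r add_Re2_Im2 normCKC mulrC.
  have r0 : 0 <= r by rewrite addr_ge0 // sqr_ge0.
  (* With [c] absorbed into [a], one has [|a|^2 <= r = |c|^2] and [|b|^2 <= 1] modulo the module, so
     [2 Re (a b) >= - (r + 1)]. *)
  exists (2^-1 * (r + 1)).
  have -> : (2^-1 * (r + 1))%:C *: 1 + pRe (c *: (mpolyX C m1 * mpolyX C m2)) =
    (2^-1)%:C *: (pbar (pbar a + b) * (pbar a + b)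
     + (r%:C *: (1 - pbar (mpolyX C m1) * mpolyX C m1)
        + (1 - pbar b * b))).
    have half : (2^-1)%:C = 2^-1 :> C by rewrite fmorphV rmorph_nat.
    rewrite rmorphM /= half -scalerA /pRe -!scalerDr; congr (_ *: _).
    rewrite -/b scalerAl -/a pbarM pbarD pbarK.
    have -> : r%:C *: (1 - pbar (mpolyX C m1) * mpolyX C m1) =
        r%:C *: 1 - pbar a * a.
      rewrite scalerBr; congr (_ - _).
      by rewrite /a pbarZ -scalerAl -scalerAr scalerA -rE.
    by rewrite rmorphD rmorph1 scalerDl scale1r; ring.
  rewrite addnn -mul2n.
  apply: qmodZ => //.
  have db : deg_le t b by apply: (deg_leW d2); exact: deg_le_mpolyX.
  have da : deg_le t a by apply/deg_leZ/(deg_leW d1); exact: deg_le_mpolyX.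
  apply: qmodD => //.
    apply: qmod_sohs => //; first exact: sohs_square.
    have dab : deg_le t (pbar a + b) by apply: deg_leD => //; exact: deg_le_pbar.
    by rewrite mul2n -addnn; apply: deg_leM => //; exact: deg_le_pbar.
  by apply: qmodD => //; [apply: qmodZ => //|]; exact: qmod_mon_bound.
rewrite -(pRe_id ph) (mpolyE p).
have : forall m, m \in msupp p -> (mdeg m <= 2 * t)%N.
  by move=> m mp; rewrite -ltnS; apply: (leq_trans _ dp); exact: msize_mdeg_lt.
elim: (msupp p) => [|m s IH] h.
  exists 0; rewrite big_nil scale0r add0r /pRe pbar0 addr0 scaler0; exact: qmod0.
have [|r rP] := IH; first by move=> m' m's; apply: h; rewrite inE m's orbT.
have [|r' r'P] := mono (mcoeff m p) m; first by apply: h; rewrite mem_head.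
exists (r' + r); rewrite big_cons pReD rmorphD scalerDl addrACA.
exact: qmodD.
Qed.

End Qmod.

(** * Positivstellensatz on the product of spheres *)

Section Positivstellensatz.
Variables (R : realType) (n : nat).
Notation C := R[i].
Notation N := (n + n + (n + n))%N.
Notation I := ('I_(n + n) * 'I_4)%type.
Implicit Types (p q h a : cpoly R n) (k : 'I_N) (u v : 'cV[C]_n) (z : 'rV[R]_N).

Definition xof z : 'cV[C]_n :=
  \col_i (z 0 (lshift (n + n) (lshift n i)) +i* z 0 (lshift (n + n) (rshift n i)))%C.
Definition yof z : 'cV[C]_n :=
  \col_i (z 0 (rshift (n + n) (lshift n i)) +i* z 0 (rshift (n + n) (rshift n i)))%C.
Definition zof u v : 'rV[R]_N := \row_k
  match fintype.split k with
  | inl j => match fintype.split j with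
             | inl i => complex.Re (u i 0) | inr i => complex.Im (u i 0) end
  | inr j => match fintype.split j with
             | inl i => complex.Re (v i 0) | inr i => complex.Im (v i 0) end
  end.

Lemma xof_zof u v : xof (zof u v) = u.
Proof.
apply/colP => i; rewrite !mxE !split_lshift ?split_rshift.
by case: (u i 0).
Qed.

Lemma yof_zof u v : yof (zof u v) = v.
Proof.
apply/colP => i; rewrite !mxE !split_rshift ?split_lshift.
by case: (v i 0).
Qed.

Lemma ReM (x y : C) :
  complex.Re (x * y) = complex.Re x * complex.Re y - complex.Im x * complex.Im y.
Proof. by case: x y => [? ?] []. Qed.

Lemma ImM (x y : C) :
  complex.Im (x * y) = complex.Re x * complex.Im y + complex.Im x * complex.Re y.
Proof. by case: x y => [? ?] []. Qed.

Lemma ReRM (r : R) (x : C) : complex.Re (r%:C * x) = r * complex.Re x.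
Proof. by rewrite ReM /= mul0r subr0. Qed.

Lemma ImRM (r : R) (x : C) : complex.Im (r%:C * x) = r * complex.Im x.
Proof. by rewrite ImM /= mul0r addr0. Qed.

Lemma ReD (x y : C) : complex.Re (x + y) = complex.Re x + complex.Re y.
Proof. by case: x y => [? ?] []. Qed.

Lemma ImD (x y : C) : complex.Im (x + y) = complex.Im x + complex.Im y.
Proof. by case: x y => [? ?] []. Qed.

Lemma Re_sum (J : Type) (r : seq J) (P : pred J) (F : J -> C) :
  complex.Re (\sum_(j <- r | P j) F j) = \sum_(j <- r | P j) complex.Re (F j).
Proof. by apply: (big_morph (@complex.Re R)) => //; exact: ReD. Qed.

Lemma Im_sum (J : Type) (r : seq J) (P : pred J) (F : J -> C) :
  complex.Im (\sum_(j <- r | P j) F j) = \sum_(j <- r | P j) complex.Im (F j).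
Proof. by apply: (big_morph (@complex.Im R)) => //; exact: ImD. Qed.

Lemma continuous_addr (T : topologicalType) (f g : T -> R) :
  continuous f -> continuous g -> continuous (fun x => f x + g x).
Proof. by move=> cf cg x; apply: cvgD; [exact: cf|exact: cg]. Qed.

Lemma continuous_env k :
  continuous (fun z => complex.Re (env (xof z) (yof z) k)) /\
  continuous (fun z => complex.Im (env (xof z) (yof z) k)).
Proof.
have cN (f : 'rV[R]_N -> R) : continuous f -> continuous (fun z => - f z).
  by move=> cf x; exact: (cvgN (cf x)).
rewrite /env; case: (split_ordP k) => j _; case: (split_ordP j) => i _;
  split => /=; under eq_fun do rewrite mxE /=;
  by [exact: coord_continuous|exact/cN/coord_continuous].
Qed.

Lemma continuous_ev p :
  continuous (fun z => complex.Re (ev (xof z) (yof z) p)) /\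
  continuous (fun z => complex.Im (ev (xof z) (yof z) p)).
Proof.
elim/mpoly_ring_ind: p => [c p q [cp cp'] [cq cq']||k p [cp cp']].
- split.
    under eq_fun do rewrite evD evZ ReD ReM.
    by apply: continuous_addr => //; apply: continuous_subr;
      apply: continuous_mulr => //; exact: cst_continuous.
  under eq_fun do rewrite evD evZ ImD ImM.
  by apply: continuous_addr => //; apply: continuous_addr;
    apply: continuous_mulr => //; exact: cst_continuous.
- by split; under eq_fun do rewrite ev1; exact: cst_continuous.
- have [ck ck'] := continuous_env k; split.
    under eq_fun do rewrite evM evX ReM.
    by apply: continuous_subr; exact: continuous_mulr.
  under eq_fun do rewrite evM evX ImM.
  by apply: continuous_addr; exact: continuous_mulr.
Qed.

Lemma ev_nrm2 b u v : ev u v (nrm2 R n b) = \sum_i `|(if b then u else v) i 0| ^+ 2.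
Proof.
rewrite nrm2.unlock /sqnorm ev_sum; apply: eq_bigr => i _.
rewrite pbarE evM ev_bar normCK; case: b; rewrite mxE evX /env.
  by rewrite !split_lshift.
by rewrite split_rshift split_lshift.
Qed.

Lemma ev_nrm2_real b u v : ev u v (nrm2 R n b) = (complex.Re (ev u v (nrm2 R n b)))%:C.
Proof.
rewrite RRe_real // ev_nrm2; apply: ger0_real.
by apply: sumr_ge0 => i _; rewrite exprn_ge0.
Qed.

Definition penalty : cpoly R n := (nrm2 R n true - 1) ^+ 2 + (nrm2 R n false - 1) ^+ 2.

Lemma ev_penalty u v : complex.Re (ev u v penalty) =
  (complex.Re (ev u v (nrm2 R n true)) - 1) ^+ 2 +
  (complex.Re (ev u v (nrm2 R n false)) - 1) ^+ 2.
Proof.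
have h b : ev u v ((nrm2 R n b - 1) ^+ 2) =
    ((complex.Re (ev u v (nrm2 R n b)) - 1) ^+ 2)%:C.
  rewrite [_ ^+ 2 in LHS]expr2 evM evB ev1; set r := complex.Re _.
  have -> : ev u v (nrm2 R n b) = r%:C by rewrite -ev_nrm2_real.
  by rewrite expr2 rmorphM rmorphB rmorph1.
by rewrite /penalty evD ReD (h true) (h false).
Qed.

(** The penalty vanishes exactly on the product of spheres, so [penalty_pos] extends positivity to
    the box of size [B] in real coordinates. *)
Lemma penalized_pos p (B : R) :
  (forall u v, \sum_i `|u i 0| ^+ 2 = 1 -> \sum_i `|v i 0| ^+ 2 = 1 ->
     0 < complex.Re (ev u v p)) ->
  exists lam delta, [/\ 0 <= lam, 0 < delta &
    forall u v, (forall k, `|zof u v 0 k| <= B) ->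
      delta <= complex.Re (ev u v (p + lam%:C *: penalty))].
Proof.
move=> p0.
pose K := [set z : 'rV[R]_N | forall k, `[- B, B]%classic (z ord0 k)].
have cK : compact K by exact: (rV_compact (fun=> @segment_compact R (- B) B)).
have [cp _] := continuous_ev p; have [cg _] := continuous_ev penalty.
have [||lam [delta [lam0 delta0 H]]] := penalty_pos cK cp cg.
- by move=> z _; rewrite ev_penalty addr_ge0 // sqr_ge0.
- move=> z _; rewrite ev_penalty => /eqP.
  rewrite paddr_eq0 ?sqr_ge0 // !sqrf_eq0 !subr_eq0 => /andP[/eqP h1 /eqP h2].
  apply: p0; first by have /= <- := ev_nrm2 true (xof z) (yof z); rewrite ev_nrm2_real h1.
  by have /= <- := ev_nrm2 false (xof z) (yof z); rewrite ev_nrm2_real h2.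
exists lam, delta; split=> // u v uvB.
have := H (zof u v); rewrite xof_zof yof_zof evD evZ ReD ReRM; apply.
by move=> k; rewrite /= in_itv /= -ler_norml.
Qed.

Definition sphere_ideal : set (cpoly R n) :=
  [set h | exists a b, h = a * (nrm2 R n true - 1) + b * (nrm2 R n false - 1)].

Lemma sphere_ideal_D h h' : sphere_ideal h -> sphere_ideal h' -> sphere_ideal (h + h').
Proof. by move=> [a [b ->]] [a' [b' ->]]; exists (a + a'), (b + b'); ring. Qed.

Lemma sphere_ideal_M q h : sphere_ideal h -> sphere_ideal (q * h).
Proof. by move=> [a [b ->]]; exists (q * a), (q * b); ring. Qed.

Lemma sphere_ideal_Z (c : C) h : sphere_ideal h -> sphere_ideal (c *: h).
Proof. by move=> Jh; rewrite -mul_mpolyC; exact: sphere_ideal_M. Qed.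

Lemma sphere_ideal0 : sphere_ideal 0.
Proof. by exists 0, 0; ring. Qed.

Lemma sphere_ideal_nrm2 b : sphere_ideal (nrm2 R n b - 1).
Proof. by case: b; [exists 1, 0|exists 0, 1]; ring. Qed.

Lemma sphere_ideal_trans q h h' : sphere_ideal (q - h) ->
  sphere_ideal (h - h') -> sphere_ideal (q - h').
Proof. by move=> j1 j2; have := sphere_ideal_D j1 j2; rewrite addrA subrK. Qed.

(** The sphere equations are Hermitian, so taking the Hermitian part of [h] only replaces the
    multipliers by their Hermitian parts, and [qmodT_ideal] applies. *)
Lemma sphere_ideal_qmod h : sphere_ideal h -> pbar h = h -> qmod setT h.
Proof.
move=> [a [b ->]] hh; rewrite -(pRe_id hh) pReD.
have sqh c : pbar (nrm2 R n c - 1) = nrm2 R n c - 1 by rewrite pbarB pbar1 nrm2_herm.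
rewrite !pReM_herm //; apply: qmodD => //; apply: qmodT_ideal; exact: pRe_herm.
Qed.

Definition hol (k : 'I_(n + n)) : 'I_N :=
  match fintype.split k with
  | inl i => lshift (n + n) (lshift n i) | inr i => rshift (n + n) (lshift n i)
  end.

Definition wsum : R := 8%:R * n%:R + 8%:R.

Lemma wsum_neq0 : wsum != 0.
Proof. by rewrite gt_eqF // ltr_wpDl // mulr_ge0. Qed.

(* |1 + i^s x|^2 = 1 + |x|^2 + 2 Re (i^s x): summed over [s] with weights
   conj(i^s) these squares give 4 x, and summed over all [s] and all [2 n] variables
   they give [wsum] modulo the sphere equations. *)
Definition Yfac (i : I) : cpoly R n := 1 + 'i ^+ i.2 *: Xpoly R (hol i.1).
Definition Y (i : I) : cpoly R n := (wsum^-1)%:C *: (pbar (Yfac i) * Yfac i).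

(** The coefficients of the coordinates in terms of the [Y i] are grouped into points of [C^n];
    [env] then supplies the conjugate coefficients for the conjugate variables. *)
Definition Ucoef (i : I) : 'cV[C]_n :=
  \col_j (if i.1 == lshift n j then (wsum / 4)%:C * ('i ^+ i.2)^* else 0).
Definition Vcoef (i : I) : 'cV[C]_n :=
  \col_j (if i.1 == rshift n j then (wsum / 4)%:C * ('i ^+ i.2)^* else 0).

Definition var_coef k (i : I) : C := env (Ucoef i) (Vcoef i) k.

Lemma sohs_Y i : sum_herm_squares (Y i).
Proof.
apply: sohsZ; last exact: sohs_square.
by rewrite invr_ge0 addr_ge0 // mulr_ge0.
Qed.

Lemma var_coef_hol (k : 'I_(n + n)) (i : I) :
  var_coef (hol k) i = if i.1 == k then (wsum / 4)%:C * ('i ^+ i.2)^* else 0.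
Proof.
rewrite /var_coef /env /hol; case: (split_ordP k) => j ->.
  by rewrite !split_lshift mxE.
by rewrite split_rshift split_lshift mxE.
Qed.

Lemma sqrCi' : 'i * 'i = -1 :> C.
Proof. by rewrite -expr2 sqrCi. Qed.

(** Fourier inversion over the fourth roots of unity: the terms in [1], [|x|^2] and [conj x] carry
    the sums of [conj(i^s)] or of its square, which vanish; only [4 x] survives. *)
Lemma Xpoly_hol (k : 'I_(n + n)) : Xpoly R (hol k) = \sum_i var_coef (hol k) i *: Y i.
Proof.
rewrite (eq_bigr (fun i : I => if i.1 == k then
   ((wsum / 4)%:C * ('i ^+ i.2)^*) *: Y (k, i.2) else 0)); last first.
  by move=> [k' s] _; rewrite var_coef_hol /=; case: eqP => [->//|_]; rewrite scale0r.
rewrite -big_mkcond /= (reindex (fun s : 'I_4 => (k, s))) /=; last first.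
  by exists snd => [//|[k' s]]; rewrite inE /= => /eqP ->.
under eq_bigl do rewrite eqxx.
under eq_bigr do rewrite /Y scalerA mulrAC -rmorphM mulrAC divff ?wsum_neq0 // mul1r -scalerA.
rewrite -scaler_sumr /Yfac /=.
set x := Xpoly R (hol k).
have E (c : C) : c * c^* = 1 ->
   c^* *: (pbar (1 + c *: x) * (1 + c *: x)) =
   c^* *: 1 + x + (c^* ^+ 2) *: pbar x + c^* *: (pbar x * x).
  move=> c1; rewrite pbarD pbarZ pbar1 mulrDl mul1r mulrDr mulr1 !scalerDr.
  rewrite !scalerA -scalerAl -scalerAr !scalerA (mulrC c^* c) c1 scale1r expr2 -!addrA.
  by rewrite -mulrA [c^* * c]mulrC c1 mulr1.
have ii m : 'i ^+ m * ('i ^+ m)^* = 1 :> C.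
  by rewrite -normCK normrX normCi !expr1n.
under eq_bigr do rewrite E ?ii //.
rewrite !big_ord_recl big_ord0 /= !rmorphXn /= conjCi.
have e2 : (- 'i) ^+ 2 = -1 :> C by rewrite sqrrN sqrCi.
have e3 : (- 'i) ^+ 3 = 'i :> C by rewrite exprS e2 mulrN1 opprK.
have e4 : (- 'i) ^+ 4 = 1 :> C by rewrite exprS e3 mulNr sqrCi' opprK.
rewrite /bump /= !add1n expr0 expr1 e3 !e2 expr1n sqrrN expr1n sqrCi.
rewrite !scale1r !scaleNr !scale1r; move: (pbar x * x) (pbar x) => P Q.
move: ('i *: (1 : cpoly R n)) ('i *: P) => A B.
rewrite [X in _ *: X](_ : _ = (4%:R : C) *: x); last by rewrite scaler_nat; ring.
by rewrite scalerA fmorphV rmorph_nat mulVf ?scale1r // pnatr_eq0.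
Qed.

Lemma hol_or_conj k : exists k' : 'I_(n + n), k = hol k' \/ k = swap_conj (hol k').
Proof.
case: (split_ordP k) => j ->; case: (split_ordP j) => i ->.
- by exists (lshift n i); left; rewrite /hol split_lshift.
- exists (lshift n i); right.
  by rewrite /hol split_lshift /swap_conj split_lshift /swap_half split_lshift.
- by exists (rshift n i); left; rewrite /hol split_rshift.
- exists (rshift n i); right.
  by rewrite /hol split_rshift /swap_conj split_rshift /swap_half split_lshift.
Qed.

Lemma XpolyE k : Xpoly R k = \sum_i var_coef k i *: Y i.
Proof.
have [k' [->|->]] := hol_or_conj k; first exact: Xpoly_hol.
rewrite -pbarX Xpoly_hol pbar_sum; apply: eq_bigr => i _.
by rewrite pbarZ (sohs_herm (sohs_Y i)) /var_coef env_swap.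
Qed.

Lemma sphere_ideal_sumY : sphere_ideal (\sum_i Y i - 1).
Proof.
have sum4 (k : 'I_(n + n)) : \sum_(s < 4) pbar (Yfac (k, s)) * Yfac (k, s) =
    (4%:R : C) *: 1 + (4%:R : C) *: (Xpoly R (hol k) * pbar (Xpoly R (hol k))).
  rewrite /Yfac /=; set x := Xpoly R (hol k).
  have E m : pbar (1 + 'i ^+ m *: x) * (1 + 'i ^+ m *: x) =
      1 + x * pbar x + 'i ^+ m *: x + (- 'i) ^+ m *: pbar x.
    rewrite pbarD pbarZ pbar1 rmorphXn /= conjCi mulrDl mul1r mulrDr mulr1.
    rewrite -scalerAl -scalerAr scalerA -exprMn mulNr -expr2 sqrCi opprK expr1n scale1r.
    by rewrite (mulrC (pbar x)); ring.
  under eq_bigr do rewrite E.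
  rewrite !big_ord_recl big_ord0 /= /bump /= !add1n.
  have i3 : 'i ^+ 3 = - 'i :> C by rewrite exprS sqrCi mulrN1.
  have e2 : (- 'i) ^+ 2 = -1 :> C by rewrite sqrrN sqrCi.
  have e3 : (- 'i) ^+ 3 = 'i :> C by rewrite exprS e2 mulrN1 opprK.
  rewrite !expr0 !expr1 e3 i3 e2 sqrCi !scaleNr !scale1r !scaler_nat.
  move: ('i *: x) ('i *: pbar x) => A B; ring.
pose F (k : 'I_(n + n)) := Xpoly R (hol k) * pbar (Xpoly R (hol k)).
have sqE : nrm2 R n true + nrm2 R n false = \sum_k F k.
  rewrite big_split_ord /=; congr (_ + _); rewrite nrm2.unlock /sqnorm;
  apply: eq_bigr => i _; rewrite mxE pbarE /F /hol.
    by rewrite split_lshift.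
  by rewrite split_rshift.
have E : \sum_i Y i = (wsum^-1)%:C *: ((4%:R * (n + n)%:R : C) *: 1 +
    (4%:R : C) *: (nrm2 R n true + nrm2 R n false)).
  rewrite /Y -scaler_sumr; congr (_ *: _).
  rewrite -(pair_bigA _ (fun (k : 'I_(n + n)) (s : 'I_4) => pbar (Yfac (k, s)) * Yfac (k, s))) /=.
  under eq_bigr do rewrite sum4.
  rewrite big_split /= sumr_const card_ord -scaler_sumr -sqE; congr (_ + _).
  by rewrite scalerMnl mulr_natr.
have one : 1 = (wsum^-1)%:C *: ((wsum%:C) *: 1) :> cpoly R n.
  by rewrite scalerA -rmorphM mulVf ?wsum_neq0 // scale1r.
rewrite E {2}one -scalerBr; apply: sphere_ideal_Z.
(* [4 (2 n + |x|^2 + |y|^2) - (8 n + 8) = 4 (|x|^2 - 1) + 4 (|y|^2 - 1)]. *)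
exists (4%:R), (4%:R).
have -> : wsum%:C = 8%:R * n%:R + 8%:R :> C by rewrite /wsum rmorphD rmorphM /= !rmorph_nat.
rewrite natrD.
have -> : 8%:R * n%:R + 8%:R = 4%:R * (n%:R + n%:R) + 8%:R :> C by ring.
rewrite scalerDl !scaler_nat; move: ((4%:R * (n%:R + n%:R)) *: 1) => A; ring.
Qed.

End Positivstellensatz.

(** * From polynomials modulo the sphere equations to forms on a simplex *)

Section SimplexLift.
Variables (R : realType) (n : nat).
Notation C := R[i].
Notation N := (n + n + (n + n))%N.
Notation I := ('I_(n + n) * 'I_4)%type.
Implicit Types (p q h : cpoly R n) (k : 'I_N) (y : I -> R).
Notation Y := (@Y R n).

(** With [vpt], the point where each variable equals its linear form in [y] ([env_pt]). It can be
    far from the spheres: constant weights [y] give the origin. *)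
Definition upt y : 'cV[C]_n := \sum_i (y i)%:C *: Ucoef R i.
Definition vpt y : 'cV[C]_n := \sum_i (y i)%:C *: Vcoef R i.

Lemma env_pt y k : env (upt y) (vpt y) k = \sum_i var_coef R k i * (y i)%:C.
Proof.
have h (W : I -> 'cV[C]_n) j : (\sum_i (y i)%:C *: W i) j ord0 = \sum_i W i j ord0 * (y i)%:C.
  by rewrite summxE; apply: eq_bigr => i _; rewrite mxE mulrC.
have hc (W : I -> 'cV[C]_n) j : ((\sum_i (y i)%:C *: W i) j ord0)^* =
    \sum_i (W i j ord0)^* * (y i)%:C.
  by rewrite h rmorph_sum; apply: eq_bigr => i _; rewrite rmorphM /= conj_realC.
rewrite /var_coef /env; case: (fintype.split k) => j; case: (fintype.split j) => i;
  by rewrite ?hc ?h.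
Qed.

Definition ext (d : nat) (g : I -> C) (f : 'I_d -> I -> C) (j : 'I_d.+1) : I -> C :=
  if unlift ord0 j is Some j' then f j' else g.

Lemma prod_ext (B : comNzRingType) (F : (I -> C) -> B) (d : nat) g
    (f : 'I_d -> I -> C) :
  \prod_(j < d.+1) F (ext g f j) = F g * \prod_(j < d) F (f j).
Proof.
rewrite big_ord_recl /ext unlift_none; congr (_ * _).
by apply: eq_bigr => j _; rewrite liftK.
Qed.

Definition formP (d : nat) (s : seq (C * ('I_d -> I -> C))) : cpoly R n :=
  \sum_(t <- s) t.1 *: \prod_j \sum_i t.2 j i *: Y i.
Definition formV (d : nat) (s : seq (C * ('I_d -> I -> C))) y : C :=
  \sum_(t <- s) t.1 * \prod_j \sum_i t.2 j i * (y i)%:C.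

(* Modulo the sphere equations, [h] is a form of degree [d] in the [Y i], with the
   same values on the simplex. *)
Definition lifted (d : nat) h := exists s : seq (C * ('I_d -> I -> C)),
  sphere_ideal (h - formP s) /\
  forall y, \sum_i y i = 1 -> ev (upt y) (vpt y) h = formV s y.

Lemma lifted_mul (d : nat) (g : I -> C) q h :
  sphere_ideal (q - \sum_i g i *: Y i) ->
  (forall y, \sum_i y i = 1 -> ev (upt y) (vpt y) q = \sum_i g i * (y i)%:C) ->
  lifted d h -> lifted d.+1 (q * h).
Proof.
move=> Jq qV [s [Js sV]]; exists [seq (t.1, ext g t.2) | t <- s]; split.
  have -> : formP [seq (t.1, ext g t.2) | t <- s] = (\sum_i g i *: Y i) * formP s.
    rewrite /formP big_map mulr_sumr; apply: eq_bigr => t _ /=.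
    by rewrite (prod_ext (fun f => \sum_i f i *: Y i)) scalerAr.
  apply: (@sphere_ideal_trans _ _ _ (q * formP s)); first by rewrite -mulrBr; exact: sphere_ideal_M.
  by rewrite -mulrBl mulrC; exact: sphere_ideal_M.
move=> y y1; rewrite evM qV // sV // /formV big_map mulr_sumr; apply: eq_bigr => t _ /=.
by rewrite (prod_ext (fun f => \sum_i f i * (y i)%:C)) mulrCA.
Qed.

Lemma lifted_deg d h : deg_le d h -> lifted d h.
Proof.
apply: mpoly_graded_ind => {d h}.
- move=> d; exists [::]; split=> [|y _]; rewrite /formP /formV big_nil.
    by rewrite subr0; exact: sphere_ideal0.
  by rewrite rmorph0.
- move=> d c p q [s [Js sV]] [s' [Js' s'V]].
  exists ([seq (c * t.1, t.2) | t <- s] ++ s'); split.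
    have -> : formP ([seq (c * t.1, t.2) | t <- s] ++ s') = c *: formP s + formP s'.
      rewrite /formP big_cat big_map scaler_sumr; congr (_ + _).
      by apply: eq_bigr => t _; rewrite scalerA.
    rewrite opprD addrACA -scalerBr; apply: sphere_ideal_D => //; exact: sphere_ideal_Z.
  move=> y y1; rewrite evD evZ sV // s'V // /formV big_cat big_map mulr_sumr.
  by congr (_ + _); apply: eq_bigr => t _; rewrite mulrA.
- exists [:: (1, fun=> fun=> 0)]; split=> [|y _].
    by rewrite /formP big_seq1 big_ord0 scale1r subrr; exact: sphere_ideal0.
  by rewrite ev1 /formV big_seq1 big_ord0 mulr1.
(* Homogenization: multiplying by [\sum_i Y i], which is 1 modulo the sphere equations, raises the
   degree without changing the class. *)
- move=> d p lp; rewrite -[p]mul1r; apply: (@lifted_mul _ (fun=> 1)) => //.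
    under eq_bigr do rewrite scale1r.
    by rewrite -opprB -scaleN1r; apply: sphere_ideal_Z; exact: sphere_ideal_sumY.
  move=> y y1; rewrite ev1; under eq_bigr do rewrite mul1r.
  by rewrite -rmorph_sum y1.
- move=> d k p lp; apply: (@lifted_mul _ (var_coef R k)) => //.
    by rewrite -XpolyE subrr; exact: sphere_ideal0.
  by move=> y _; rewrite evX env_pt.
Qed.

(** The box depends on [n] alone, so it can be fixed before the penalty multiplier, which depends on
    it. *)
Lemma zof_bound : exists B : R, forall y, (forall i, 0 <= y i) -> \sum_i y i = 1 ->
  forall k, `|zof (upt y) (vpt y) 0 k| <= B.
Proof.
pose z i := zof (Ucoef R i) (Vcoef R i) : 'rV[R]_N.
exists (\sum_i \sum_k `|z i 0 k|) => y y0 y1 k.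
have -> : zof (upt y) (vpt y) 0 k = \sum_i y i * z i 0 k.
  rewrite mxE /upt /vpt /z; case E : (fintype.split k) => [j|j];
  case E' : (fintype.split j) => [i|i]; rewrite summxE ?Re_sum ?Im_sum;
  by apply: eq_bigr => l _; rewrite !mxE E E' ?mxE ?ReRM ?ImRM ?mxE.
apply: le_trans (ler_norm_sum _ _ _) _; apply: ler_sum => i _.
rewrite normrM ger0_norm // -[leRHS]mul1r; apply: ler_pM => //.
  by rewrite -y1 (bigD1 i) //= lerDl sumr_ge0.
by rewrite (bigD1 k) //= lerDl sumr_ge0.
Qed.

Lemma sphere_ideal_pow N' : sphere_ideal ((\sum_i Y i) ^+ N' - 1).
Proof.
elim: N' => [|m IH]; first by rewrite expr0 subrr; exact: sphere_ideal0.
apply: (@sphere_ideal_trans _ _ _ (\sum_i Y i)); last exact: sphere_ideal_sumY.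
by rewrite exprS -[X in _ - X]mulr1 -mulrBr; exact: sphere_ideal_M.
Qed.

Theorem positivstellensatz p : pbar p = p ->
  (forall u v : 'cV[C]_n, \sum_i `|u i 0| ^+ 2 = 1 -> \sum_i `|v i 0| ^+ 2 = 1 ->
     0 < complex.Re (ev u v p)) ->
  qmod setT p.
Proof.
move=> ph ppos; have [B Bbound] := zof_bound.
have [lam [delta [lam0 delta0 H]]] := penalized_pos B ppos.
set p' := p + lam%:C *: penalty R n in H.
have [d dp'] := deg_le_exists p'.
have [s [Js sV]] := lifted_deg dp'.
have [y y0 y1|N' [M [b [b0 bE]]]] := polya Y delta0 (s := s).
  rewrite -/(formV s y) -sV //; apply: H; exact: Bbound.
pose Yw (w : {ffun 'I_M -> I}) := \prod_r Y (w r).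
have Yw_sohs w : sum_herm_squares (Yw w).
  by rewrite /Yw; elim/big_ind: _ => [|? ?|r _]; [exact: sohs1|exact: sohsM|exact: sohs_Y].
have Jp : sphere_ideal (p - \sum_w b w *: Yw w).
  rewrite -bE; apply: (@sphere_ideal_trans _ _ _ p').
    rewrite /p' opprD addrA subrr sub0r -scaleNr; apply: sphere_ideal_Z.
    rewrite /penalty !expr2.
    by apply: sphere_ideal_D; apply: sphere_ideal_M; exact: sphere_ideal_nrm2.
  apply: (@sphere_ideal_trans _ _ _ (formP s)) => //; rewrite -/(formP s).
  rewrite -[X in X - _]mulr1 -mulrBr; apply: sphere_ideal_M.
  by rewrite -opprB -scaleN1r; apply: sphere_ideal_Z; exact: sphere_ideal_pow.
(* Polya's theorem controls only the real parts of the coefficients. As the [Yw w] are Hermitian,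
   taking the Hermitian part keeps precisely those. *)
pose S := \sum_w (complex.Re (b w))%:C *: Yw w.
have SE : pRe (\sum_w b w *: Yw w) = S.
  rewrite /pRe pbar_sum -big_split scaler_sumr; apply: eq_bigr => w _ /=.
  rewrite pbarZ (sohs_herm (Yw_sohs w)) -scalerDl scalerA; congr (_ *: _).
  by rewrite ReJ_add mulrC.
have S_qmod : qmod setT S.
  apply: qmod_sum => // w _; apply: qmod_sohs => //; exact: sohsZ.
have -> : p = S + (p - S) by rewrite addrC subrK.
apply: qmodD => //; apply: sphere_ideal_qmod; last first.
  by rewrite pbarB ph -SE pRe_herm.
rewrite -SE -{1}(pRe_id ph) -pReB.
case: Jp => a [c ->]; rewrite pReD.
have sqh t : pbar (nrm2 R n t - 1) = nrm2 R n t - 1 by rewrite pbarB pbar1 nrm2_herm.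
by rewrite !pReM_herm //; exists (pRe a), (pRe c).
Qed.

End SimplexLift.

(** * Duality *)

Section CostAndForms.
Variables (R : realType) (n : nat).
Notation C := R[i].
Notation N := (n + n + (n + n))%N.
Implicit Types (p q h : cpoly R n) (A B : 'M[C]_n) (b : bool).

Definition block_vec b : 'cV[cpoly R n]_n := if b then xvec R n else yvec R n.

Definition outer_poly (i j : 'I_n) : cpoly R n :=
  xvec R n i 0 * pbar (xvec R n j 0) - yvec R n i 0 * pbar (yvec R n j 0).

Lemma mul_padj (x : 'cV[cpoly R n]_n) i j :
  (x *m padj x) i j = x i 0 * pbar (x j 0).
Proof. by rewrite !mxE big_ord1 /padj !mxE pbarE. Qed.

Lemma outer_polyE i j :
  (xvec R n *m padj (xvec R n) - yvec R n *m padj (yvec R n)) i j = outer_poly i j.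
Proof.
rewrite /outer_poly -!mul_padj.
by move: (xvec R n *m _) (yvec R n *m _) => A B; rewrite !mxE.
Qed.

Lemma cost_polyE :
  cost_poly R n = \sum_i \sum_j outer_poly i j * pbar (outer_poly j i).
Proof.
rewrite /cost_poly /mxtrace; apply: eq_bigr => i _; rewrite mxE.
apply: eq_bigr => j _; rewrite [map_mx _ _ _ _]mxE pbarE.
by rewrite !outer_polyE.
Qed.

Lemma deg_block_vec b i : deg_le 1 (block_vec b i 0).
Proof. by case: b; rewrite mxE; exact: deg_leX. Qed.

Lemma deg_outer_block b i j : deg_le 2 (block_vec b i 0 * pbar (block_vec b j 0)).
Proof. by apply: (@deg_leM _ _ 1 1); [|apply: deg_le_pbar]; exact: deg_block_vec. Qed.

Lemma deg_cost : deg_le 4 (cost_poly R n).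
Proof.
have d i j : deg_le 2 (outer_poly i j).
  by apply: deg_leB; [exact: (deg_outer_block true)|exact: (deg_outer_block false)].
rewrite cost_polyE; apply: deg_le_sum => i _; apply: deg_le_sum => j _.
by apply: (@deg_leM _ _ 2 2) => //; exact: deg_le_pbar.
Qed.

Lemma cost_herm : pbar (cost_poly R n) = cost_poly R n.
Proof.
rewrite cost_polyE pbar_sum.
under eq_bigr do rewrite pbar_sum.
rewrite exchange_big /=; apply: eq_bigr => i _; apply: eq_bigr => j _.
rewrite pbarM pbarK; exact: mulrC.
Qed.

Definition block_form b A : cpoly R n :=
  \sum_i \sum_j A i j *: (pbar (block_vec b i 0) * block_vec b j 0).

Lemma qformE b A : qform (block_vec b) A = block_form b A.
Proof.
rewrite /qform /block_form mxE [RHS]exchange_big; apply: eq_bigr => j _ /=.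
rewrite mxE mulr_suml; apply: eq_bigr => i _.
by rewrite /padj !mxE pbarE -mul_mpolyC mulrCA mulrA.
Qed.

Lemma block_form_lin b (c : C) A B :
  block_form b (c *: A + B) = c *: block_form b A + block_form b B.
Proof.
rewrite /block_form scaler_sumr -big_split; apply: eq_bigr => i _ /=.
rewrite scaler_sumr -big_split; apply: eq_bigr => j _ /=.
by rewrite !mxE scalerDl scalerA.
Qed.

Lemma block_form0 b : block_form b 0 = 0.
Proof. by rewrite /block_form big1 // => i _; rewrite big1 // => j _; rewrite mxE scale0r. Qed.

Lemma block_formZ b (c : C) A : block_form b (c *: A) = c *: block_form b A.
Proof. by have := block_form_lin b c A 0; rewrite block_form0 !addr0. Qed.

Lemma block_formD b A B : block_form b (A + B) = block_form b A + block_form b B.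
Proof. by have := block_form_lin b 1 A B; rewrite !scale1r. Qed.

Lemma block_form1 b : block_form b 1%:M = nrm2 R n b.
Proof.
rewrite nrm2.unlock /sqnorm /block_form; apply: eq_bigr => i _.
rewrite (bigD1 i) //= big1 => [|j /negPf ji]; last by rewrite mxE eq_sym ji scale0r.
by rewrite mxE eqxx scale1r addr0 pbarE mulrC.
Qed.

Lemma block_form_delta b i j :
  block_form b (delta_mx i j) = pbar (block_vec b i 0) * block_vec b j 0.
Proof.
rewrite /block_form (bigD1 i) //= [X in _ + X]big1 => [|k /negPf ki]; last first.
  by rewrite big1 // => l _; rewrite mxE ki scale0r.
rewrite addr0 (bigD1 j) //= big1 => [|l /negPf lj]; last by rewrite mxE lj andbF scale0r.
by rewrite mxE !eqxx scale1r addr0.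
Qed.

Lemma pbar_block_form b A : pbar (block_form b A) = block_form b (A ^t*).
Proof.
rewrite /block_form pbar_sum exchange_big /=; apply: eq_bigr => i _.
rewrite pbar_sum; apply: eq_bigr => j _.
by rewrite pbarZ pbarM pbarK !mxE mulrC.
Qed.

Lemma deg_block_form b A : deg_le 2 (block_form b A).
Proof.
apply: deg_le_sum => i _; apply: deg_le_sum => j _; apply: deg_leZ.
by rewrite mulrC; exact: deg_outer_block.
Qed.

Lemma tr_conj A B : A ^t* = A -> \tr (A *m B ^t*) = (\tr (A *m B))^*.
Proof.
move=> Ah; rewrite -{1}Ah -map_mxM -trmx_mul.
by rewrite trace_map_mx mxtrace_tr mxtrace_mulC.
Qed.

End CostAndForms.

Section Duality.
(* [D] is [deg_le (2 * t)] with [2 <= t], or [setT]. *)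
Variables (R : realType) (n : nat) (D : set (cpoly R n)) (rho nu : 'M[R[i]]_n).
Notation C := R[i].
Notation f := (cost_poly R n).
Implicit Types (p q h : cpoly R n) (A B : 'M[C]_n).
Hypothesis D_lin : forall (c : C) p q, D p -> D q -> D (c *: p + q).
Hypothesis D_bar : forall p, D p -> D (pbar p).
Hypothesis D_deg : deg_le 4 `<=` D.
Hypothesis D_unit : forall p, D p -> pbar p = p -> exists r : R, qmod D (r%:C *: 1 + p).
Hypotheses (rho_herm : rho ^t* = rho) (nu_herm : nu ^t* = nu).
Hypothesis rho_tr : \tr rho = 1.

Let D0 : D 0. Proof. exact/D_deg/deg_le0. Qed.
Let DD p q : D p -> D q -> D (p + q).
Proof. by move=> Dp Dq; have := D_lin 1 Dp Dq; rewrite scale1r. Qed.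
Let DZ (c : C) p : D p -> D (c *: p).
Proof. by move=> Dp; have := D_lin c Dp D0; rewrite addr0. Qed.
Let D_real : real_subspace D.
Proof. by split=> // r p; exact: DZ. Qed.
Let Dqf b A : D (block_form b A).
Proof. by apply/D_deg/(deg_leW _ (deg_block_form _ _)). Qed.
Let DpRe p : D p -> D (pRe p).
Proof. by move=> Dp; apply/DZ/DD => //; exact: D_bar. Qed.
Let DpIm p : D p -> D (pIm p).
Proof. by move=> Dp; apply/DpRe/DZ. Qed.
Let Df : D f. Proof. exact/D_deg/deg_cost. Qed.
Let D1 : D 1. Proof. exact/D_deg/deg_le1. Qed.
Let Dsq b : D (nrm2 R n b).
Proof. by apply/D_deg/(deg_leW _ (@deg_nrm2 _ _ b)). Qed.

(** Both signs of each sphere equation are generators, so a constant of either sign may be traded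
    for a multiple of the squared norm, that is, absorbed into a quadratic form. *)
Lemma qmod_const b (r : R) : qmod D (r%:C *: (1 - nrm2 R n b)).
Proof.
have pos : D (1 - nrm2 R n b) by apply: DD => //; rewrite -scaleN1r; exact: DZ.
have [r0|r0] := leP 0 r.
  apply: qmodZ => //; rewrite -[X in qmod _ X]mul1r; apply: qmod_nrm2 => //.
    exact: sohs1.
  by rewrite mul1r.
rewrite -[r]opprK rmorphN scaleNr -scalerN opprB.
apply: qmodZ => //; first by rewrite oppr_ge0 ltW.
rewrite -[X in qmod _ X]mul1r; apply: qmod_nrm2N => //; first exact: sohs1.
by rewrite mul1r -opprB -scaleN1r; exact: DZ.
Qed.

Let dual_obj A B : R := complex.Re (\tr (rho *m A + nu *m B)).

Let dual_obj_lin (r : R) A B A' B' :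
  dual_obj (r%:C *: A + A') (r%:C *: B + B') = r * dual_obj A B + dual_obj A' B'.
Proof.
rewrite /dual_obj !mulmxDr -!scalemxAr addrACA -scalerDr (mxtraceD (r%:C *: _)) mxtraceZ.
by rewrite ReD ReRM.
Qed.

(** The cone [K] contains only forms of dual objective 0; since [Tr rho = 1], a multiple of the
    identity adjusts the objective to exactly [c]. So [f - c] in [K] means a dual point of value
    [c], and otherwise separation gives a moment functional. *)
Lemma dual_or_primal (c : R) :
  (exists LG : 'M[C]_n * 'M[C]_n, [/\ LG.1 ^t* = LG.1, LG.2 ^t* = LG.2,
     qmod D (f - qform (xvec R n) LG.1 - qform (yvec R n) LG.2)
     & complex.Re (\tr (rho *m LG.1 + nu *m LG.2)) = c]) \/
  (exists2 L, feasible D (qmod D) rho nu L & complex.Re (L f) <= c).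
Proof.
pose S := [set p | D p /\ pbar p = p].
pose K := [set q | exists g A B, [/\ qmod D g, A ^t* = A, B ^t* = B, dual_obj A B = 0
   & q = g + (block_form true A + block_form false B)]].
have hermD A B : A ^t* = A -> B ^t* = B -> (A + B) ^t* = A + B.
  by move=> Ah Bh; rewrite linearD map_mxD Ah Bh.
have hermZ (r : R) A : A ^t* = A -> (r%:C *: A) ^t* = r%:C *: A.
  by move=> Ah; rewrite linearZ map_mxZ /= Ah conj_realC.
have herm1 : (1%:M : 'M[C]_n) ^t* = 1%:M by rewrite trmx1 map_mx1.
have ell1 : dual_obj 1%:M 0 = 1 by rewrite /dual_obj mulmx1 mulmx0 addr0 rho_tr.
have [Kf|NKf] := pselect (K (f - c%:C *: 1)).
  left; case: Kf => g [A [B [Qg Ah Bh AB0 E]]].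
  exists (c%:C *: 1%:M + A, B) => /=; split=> //.
  - by apply: hermD => //; exact: hermZ.
  - rewrite (qformE true) (qformE false) block_form_lin block_form1.
    have -> : f = g + (block_form true A + block_form false B) + c%:C *: 1 by rewrite -E subrK.
    have -> : g + (block_form true A + block_form false B) + c%:C *: 1 -
        (c%:C *: nrm2 R n true + block_form true A) - block_form false B =
        g + c%:C *: (1 - nrm2 R n true).
      rewrite scalerBr; move: (c%:C *: 1) (c%:C *: nrm2 R n true) => X Y; ring.
    by apply: qmodD => //; exact: qmod_const.
  - by have := dual_obj_lin c 1%:M 0 A B; rewrite scaler0 add0r AB0 ell1 addr0 mulr1.
right.
have S_sub (r : R) q q' : S q -> S q' -> S (r%:C *: q + q').
  move=> [Dq qh] [Dq' q'h]; split; first exact: D_lin.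
  by rewrite pbar_lin conj_realC qh q'h.
have coneK : real_cone K.
  split=> [_ _ [g [A [B [Qg Ah Bh AB ->]]]] [g' [A' [B' [Qg' Ah' Bh' AB' ->]]]]|
           r _ r0 [g [A [B [Qg Ah Bh AB ->]]]]].
    exists (g + g'), (A + A'), (B + B'); split; [exact: qmodD|exact: hermD|exact: hermD| |].
      by have := dual_obj_lin 1 A B A' B'; rewrite !scale1r AB AB' mulr0 addr0.
    rewrite !block_formD.
    move: (block_form true A) (block_form true A').
    move: (block_form false B) (block_form false B').
    by move=> b b' a a'; rewrite (addrACA g) (addrACA a).
  exists (r%:C *: g), (r%:C *: A), (r%:C *: B); split.
  - exact: qmodZ.
  - exact: hermZ.
  - exact: hermZ.
  - have := dual_obj_lin r A B 0 0; rewrite !addr0 AB mulr0 add0r => ->.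
    by rewrite /dual_obj !mulmx0 addr0 mxtrace0.
  - by rewrite !block_formZ !scalerDr.
have KQ q : qmod D q -> K q.
  move=> Qq; exists q, 0, 0; split=> //; rewrite ?trmx0 ?map_mx0 //.
    by rewrite /dual_obj !mulmx0 addr0 mxtrace0.
  by rewrite !block_form0 !addr0.
have KS : K `<=` S.
  move=> _ [g [A [B [Qg Ah Bh AB ->]]]]; split.
    apply: DD; first exact: qmod_sub_dom.
    exact: DD.
  by rewrite !pbarD (qmod_herm Qg) !pbar_block_form Ah Bh.
have K1 : K 1 by apply/KQ/qmod_sohs => //; exact: sohs1.
have unitK q : S q -> exists r : R, K (r%:C *: 1 + q).
  by move=> [Dq qh]; have [r Qr] := D_unit Dq qh; exists r; exact: KQ.
have Sf : S f by split=> //; exact: cost_herm.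
have S1 : S 1 by exact: KS.
have Sp : S (f - c%:C *: 1).
  by rewrite addrC -scaleNr -rmorphN; exact: S_sub.
have [psi [psi_lin psi_pos psi1 psif]] := cone_separation S_sub coneK KS K1 unitK Sp NKf.
have S0 : S 0 by split=> //; exact: pbar0.
have psi0 : psi 0 = 0.
  by have := psi_lin 1 0 0 S0 S0; rewrite scaler0 addr0; lra.
have SRe p : D p -> S (pRe p) by move=> Dp; split; [exact: DpRe|exact: pRe_herm].
have SIm p : D p -> S (pIm p) by move=> Dp; split; [exact: DpIm|exact: pRe_herm].
have psiZ (r : R) q : S q -> psi (r%:C *: q) = r * psi q.
  by move=> Sq; have := psi_lin r q 0 Sq S0; rewrite psi0 !addr0.
have psiD q q' : S q -> S q' -> psi (q + q') = psi q + psi q'.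
  by move=> Sq Sq'; have := psi_lin 1 q q' Sq Sq'; rewrite scale1r mul1r.
pose phi p := psi (pRe p).
have phi_lin (r : R) p q : D p -> D q -> phi (r%:C *: p + q) = r * phi p + phi q.
  by move=> Dp Dq; rewrite /phi pReD pReZ psi_lin //; exact: SRe.
have phiN p : D p -> phi (- p) = - phi p.
  move=> Dp; have := phi_lin (-1) p 0 Dp D0.
  by rewrite rmorphN rmorph1 scaleN1r addr0 /phi (pRe_id (@pbar0 R n)) psi0 addr0 mulN1r.
(* The complex functional whose real part is [phi]. *)
pose L p : C := (phi p +i* phi (- 'i *: p))%C.
have L_lin (z : C) p q : D p -> D q -> L (z *: p + q) = z * L p + L q.
  move=> Dp Dq; case: z => a b; rewrite /L.
  rewrite scale_complex_split scaleNi_split.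
  have ip : 'i *: p = - (- 'i *: p) by rewrite scaleNr opprK.
  rewrite phi_lin //; last by apply: D_lin => //; exact: DZ.
  rewrite phi_lin //; last exact: DZ.
  rewrite phi_lin; [|exact: DZ|by apply: D_lin => //; exact: DZ].
  rewrite phi_lin //; last exact: DZ.
  rewrite ip phiN; last exact: DZ.
  by apply/eqP; rewrite eq_complex /=; apply/andP; split; apply/eqP; ring.
have L_herm h : S h -> L h = (psi h)%:C.
  move=> [Dh hh]; rewrite /L /phi pRe_id //.
  have -> : pRe (- 'i *: h) = 0.
    rewrite /pRe pbarZ rmorphN /= conjCi opprK hh -scalerDl addNr.
    by rewrite scale0r scaler0.
  by rewrite psi0.
have pRe_bar p : pRe (pbar p) = pRe p by rewrite /pRe pbarK addrC.
have L_bar p : D p -> L (pbar p) = (L p)^*.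
  move=> Dp; rewrite /L /phi pRe_bar.
  have -> : - 'i *: pbar p = - pbar (- 'i *: p).
    by rewrite pbarZ rmorphN /= conjCi opprK scaleNr.
  have := phiN (pbar (- 'i *: p)); rewrite /phi pRe_bar => -> //.
  exact/D_bar/DZ.
have psi_sq : psi (nrm2 R n true) = 1.
  have Ssq : S (nrm2 R n true) by split=> //; exact: nrm2_herm.
  have e r : psi (r%:C *: (1 - nrm2 R n true)) = r * (1 - psi (nrm2 R n true)).
    have -> : r%:C *: (1 - nrm2 R n true) = (- r)%:C *: nrm2 R n true + r%:C *: 1.
      by rewrite scalerBr rmorphN scaleNr addrC.
    rewrite psi_lin //; last by have := S_sub r 1 0 S1 S0; rewrite addr0.
    by rewrite psiZ // psi1; ring.
  have := psi_pos _ (KQ _ (qmod_const true 1)); rewrite e.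
  have := psi_pos _ (KQ _ (qmod_const true (-1))); rewrite e.
  lra.
have Sqf b A : A ^t* = A -> S (block_form b A).
  by move=> Ah; split=> //; rewrite pbar_block_form Ah.
have psi_ell A B : A ^t* = A -> B ^t* = B ->
    psi (block_form true A + block_form false B) = dual_obj A B.
  move=> Ah Bh; set r := dual_obj A B.
  have ker A' B' : A' ^t* = A' -> B' ^t* = B' -> dual_obj A' B' = 0 ->
      0 <= psi (block_form true A' + block_form false B').
    move=> Ah' Bh' AB0; apply: psi_pos; exists 0, A', B'; split => //.
      exact: qmod0.
    by rewrite add0r.
  have SAB : S (block_form true A + block_form false B).
    by have := S_sub 1 _ _ (Sqf true _ Ah) (Sqf false _ Bh); rewrite scale1r.
  (* Subtracting [r] times the identity from [A] gives a pair of objective 0, so all its real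
     multiples are in [K]; taking [t = 1] and [t = -1] forces equality. *)
  have main (t : R) : 0 <= t * (psi (block_form true A + block_form false B) - r).
    have ell0 : dual_obj (t%:C *: ((- r)%:C *: 1%:M + A)) (t%:C *: B) = 0.
      have -> : t%:C *: ((- r)%:C *: 1%:M + A) =
          (- (t * r))%:C *: 1%:M + t%:C *: A.
        by rewrite scalerDr scalerA -rmorphM mulrN.
      have := dual_obj_lin (- (t * r)) 1%:M 0 (t%:C *: A) (t%:C *: B).
      rewrite scaler0 add0r => ->.
      have := dual_obj_lin t A B 0 0; rewrite !addr0 => ->.
      by rewrite ell1 /dual_obj !mulmx0 addr0 mxtrace0 -/(dual_obj A B) -/r /=; ring.
    have := ker _ _ (hermZ t _ (hermD _ _ (hermZ (- r) _ herm1) Ah)) (hermZ t _ Bh) ell0.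
    rewrite !block_formZ -scalerDr block_form_lin block_form1 -addrA psiZ.
      rewrite psi_lin //; last by split=> //; exact: nrm2_herm.
      by rewrite psi_sq mulr1 (addrC (- r)).
    by apply: S_sub => //; split=> //; exact: nrm2_herm.
  by have := main 1; have := main (-1); lra.
(* [psi] sees only the Hermitian part [H A]; because [rho] and [nu] are Hermitian, it has the same
   real trace as [A], and the imaginary part follows from [- i A]. *)
have L_qf (b : bool) A : L (block_form b A) = \tr ((if b then rho else nu) *m A).
  have HA B : (B + B ^t*) ^t* = B + B ^t*.
    by rewrite linearD map_mxD trmxCK addrC.
  pose H B := (2^-1)%:C *: (B + B ^t*).
  have Hh B : (H B) ^t* = H B by apply: hermZ.
  have pReH B : pRe (block_form b B) = block_form b (H B).
    by rewrite /pRe pbar_block_form -block_formD /H block_formZ fmorphV rmorph_nat.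
  have z0 : (0 : 'M[C]_n) ^t* = 0 by rewrite trmx0 map_mx0.
  have trH B : psi (block_form b (H B)) = complex.Re (\tr ((if b then rho else nu) *m B)).
    have gen (sg : 'M[C]_n) : sg ^t* = sg ->
        complex.Re (\tr (sg *m H B)) = complex.Re (\tr (sg *m B)).
      move=> sgh; rewrite /H -scalemxAr mxtraceZ mulmxDr mxtraceD tr_conj // ReRM.
      by case: (\tr (sg *m B)) => x y /=; lra.
    case: b pReH => _ /=.
      by have := psi_ell _ _ (Hh B) z0; rewrite block_form0 addr0 /dual_obj mulmx0 addr0 gen.
    by have := psi_ell _ _ z0 (Hh B); rewrite block_form0 add0r /dual_obj mulmx0 add0r gen.
  rewrite /L /phi -block_formZ !pReH !trH -scalemxAr mxtraceZ.
  rewrite mulNr -complexiE; case: (\tr _) => x y; apply/eqP.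
  by rewrite eq_complex /=; apply/andP; split; apply/eqP; ring.
have L_entry b i j : L (block_vec R n b i 0 * pbar (block_vec R n b j 0)) =
    (if b then rho else nu) i j.
  rewrite mulrC -block_form_delta L_qf; set sg := if b then _ else _.
  rewrite /mxtrace (bigD1 i) //= big1 => [|k ki]; last first.
    rewrite mxE big1 // => l _; rewrite mxE; case: eqP => //= [_|]; last by rewrite mulr0.
    by rewrite (negPf ki) mulr0.
  rewrite addr0 mxE (bigD1 j) //= big1 => [|l lj]; last by rewrite mxE (negPf lj) mulr0.
  by rewrite mxE !eqxx mulr1 addr0.
exists L; first split => //.
- by move=> p Dp; rewrite pbarE; exact: L_bar.
- by apply/matrixP => i j; rewrite mxE mul_padj; exact: (L_entry true).
- by apply/matrixP => i j; rewrite mxE mul_padj; exact: (L_entry false).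
- move=> q Qq; rewrite L_herm; last exact/KS/KQ.
  by rewrite realC_ge0; apply/psi_pos/KQ.
rewrite L_herm //=.
have := psif; rewrite addrC -scaleNr -rmorphN psi_lin // psi1; lra.
Qed.

End Duality.

(** * Transport plans and moment functionals *)

Section Plans.
Variables (R : realType) (n : nat).
Notation C := R[i].
Notation N := (n + n + (n + n))%N.
Notation f := (cost_poly R n).
Implicit Types (p q h : cpoly R n) (u v : 'cV[C]_n) (e : seq (triple R n)).

Lemma enorm_eq1 u : enorm u = 1 <-> \sum_i `|u i 0| ^+ 2 = 1.
Proof.
rewrite /enorm; split=> [h|->]; last by rewrite sqrtC1.
by rewrite -[LHS]sqrtCK h expr1n.
Qed.

Definition plan_fun e p : C := \sum_(a <- e) a.1.1%:C * ev a.1.2 a.2 p.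

Lemma ev_block_vec b u v i : ev u v (block_vec R n b i 0) = (if b then u else v) i 0.
Proof.
rewrite /block_vec; case: b; rewrite mxE evX /env ?split_lshift ?split_rshift //.
by rewrite split_lshift.
Qed.

Lemma ev_outer_block u v b i j : ev u v (block_vec R n b i 0 * pbar (block_vec R n b j 0)) =
  let w := if b then u else v in (w *m w ^t*) i j.
Proof. by rewrite evM ev_bar !ev_block_vec /=; case: b; rewrite !mxE big_ord1 !mxE. Qed.

Lemma ev_cost u v : ev u v f = pure_cost u v.
Proof.
rewrite cost_polyE ev_sum /pure_cost /mxtrace; apply: eq_bigr => i _.
rewrite ev_sum mxE; apply: eq_bigr => j _.
have E k l : ev u v (outer_poly R k l) = (u *m u ^t* - v *m v ^t*) k l.
  rewrite /outer_poly evB (ev_outer_block _ _ true) (ev_outer_block _ _ false) /=.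
  by move: (u *m _) (v *m _) => A B; rewrite !mxE.
by rewrite evM ev_bar !E [map_mx _ _ _ _]mxE.
Qed.

Lemma T2E e : T2 e = plan_fun e f.
Proof. by apply: eq_bigr => a _; rewrite ev_cost. Qed.

Lemma ev_qmod_ge0 u v q : \sum_i `|u i 0| ^+ 2 = 1 -> \sum_i `|v i 0| ^+ 2 = 1 ->
  qmod setT q -> 0 <= ev u v q.
Proof.
move=> u1 v1 [s sP ->]; rewrite ev_sum; apply: sumr_ge0 => j _.
have sq1 b : ev u v (nrm2 R n b) = 1 by rewrite ev_nrm2; case: b.
rewrite evM; apply: mulr_ge0.
  have [/sohsE[ps ->] _] := sP j; rewrite ev_sum; apply: sumr_ge0 => p _.
  by rewrite evM ev_bar mulrC -normCK exprn_ge0.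
have g1 b : ev u v (1 - nrm2 R n b) = 0 by rewrite evB (sq1 b) ev1 subrr.
have g2 b : ev u v (nrm2 R n b - 1) = 0 by rewrite evB (sq1 b) ev1 subrr.
move: (g1 true) (g2 true) (g1 false) (g2 false); rewrite nrm2.unlock => h1 h2 h3 h4.
case: j => [[|[|[|[|[|//]]]]] j]; rewrite /tnth /=.
- by rewrite ev1.
- by rewrite h1.
- by rewrite h2.
- by rewrite h3.
- by rewrite h4.
Qed.

Variables (rho nu : 'M[C]_n).

Lemma plan_feasible e : transport_plan rho nu e ->
  feasible setT (qmod setT) rho nu (plan_fun e).
Proof.
move=> [eP e1 erho enu]; split.
- move=> c p q _ _; rewrite /plan_fun mulr_sumr -big_split; apply: eq_bigr => a _ /=.
  by rewrite evD evZ mulrDr mulrCA.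
- move=> p _; rewrite pbarE /plan_fun rmorph_sum; apply: eq_bigr => a _ /=.
  by rewrite ev_bar rmorphM /= conj_realC.
- apply/matrixP => i j; rewrite mxE mul_padj -erho summxE; apply: eq_bigr => a _.
  by rewrite (ev_outer_block _ _ true) [RHS]mxE.
- apply/matrixP => i j; rewrite mxE mul_padj -enu summxE; apply: eq_bigr => a _.
  by rewrite (ev_outer_block _ _ false) [RHS]mxE.
- move=> q Qq; rewrite /plan_fun big_seq; apply: sumr_ge0 => a /eP[a0 u1 v1].
  apply: mulr_ge0; first by rewrite realC_ge0 ltW.
  by apply: ev_qmod_ge0 => //; exact/enorm_eq1.
Qed.

Hypothesis rho_tr : \tr rho = 1.
Hypothesis n_gt0 : (0 < n)%N.

Definition sphere2 : set 'rV[R]_N :=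
  [set z | complex.Re (ev (xof z) (yof z) (nrm2 R n true)) = 1 /\
           complex.Re (ev (xof z) (yof z) (nrm2 R n false)) = 1].

Lemma sphere2P z : sphere2 z <->
  \sum_i `|xof z i 0| ^+ 2 = 1 /\ \sum_i `|yof z i 0| ^+ 2 = 1.
Proof.
have <- := ev_nrm2 true (xof z) (yof z); have <- := ev_nrm2 false (xof z) (yof z).
split=> [[h1 h2]|[h1 h2]]; last by rewrite /sphere2 /= h1 h2.
by rewrite (ev_nrm2_real true) h1 (ev_nrm2_real false) h2.
Qed.

Lemma sphere2_compact : compact sphere2.
Proof.
pose K := [set z : 'rV[R]_N | forall k, `[- 1, 1]%classic (z ord0 k)].
have cK : compact K by exact: (rV_compact (fun=> @segment_compact R (- 1) 1)).
have closedS : closed sphere2.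
  have cl b : closed [set z | complex.Re (ev (xof z) (yof z) (nrm2 R n b)) = 1].
    apply: (@closed_comp _ _ (fun z => complex.Re (ev (xof z) (yof z) (nrm2 R n b))) [set 1]).
      by move=> z _; have [c _] := continuous_ev (nrm2 R n b); exact: c.
    exact: closed_eq.
  exact: (closedI (cl true) (cl false)).
apply: (subclosed_compact closedS cK) => z /sphere2P[zx zy] k.
have bound (w : 'cV[C]_n) i : \sum_i `|w i 0| ^+ 2 = 1 ->
    `|complex.Re (w i 0)| <= 1 /\ `|complex.Im (w i 0)| <= 1.
  move=> w1; have : `|w i 0| ^+ 2 <= 1.
    by rewrite -w1 (bigD1 i) //= lerDl sumr_ge0 // => j _; rewrite exprn_ge0.
  rewrite -add_Re2_Im2 -[X in _ <= X](rmorph1 (@real_complex R)) lecR => h.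
  have h1 := sqr_ge0 (complex.Re (w i 0)); have h2 := sqr_ge0 (complex.Im (w i 0)).
  by split; rewrite -(@ler_pXn2r _ 2) ?nnegrE // expr1n real_normK ?num_real //; lra.
rewrite /= in_itv /= -ler_norml.
have entry : forall j, z ord0 j = zof (xof z) (yof z) 0 j.
  move=> j; rewrite mxE; case: (split_ordP j) => l ->; case: (split_ordP l) => i ->;
  by rewrite mxE.
rewrite entry mxE; case: (fintype.split k) => l; case: (fintype.split l) => i.
- by have [] := bound _ i zx.
- by have [] := bound _ i zx.
- by have [] := bound _ i zy.
- by have [] := bound _ i zy.
Qed.

(** The marginals are absent from the conclusion: they are moments too, recovered by listing the
    entries of the outer products in [qs]. *)
Lemma moment_plan L : feasible setT (qmod setT) rho nu L -> forall qs : seq (cpoly R n),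
  exists e : seq (triple R n),
  [/\ forall a, a \in e -> [/\ 0 < a.1.1, enorm a.1.2 = 1 & enorm a.2 = 1],
      \sum_(a <- e) a.1.1 = 1
    & forall q, q \in qs -> plan_fun e q = L q].
Proof.
move=> [L_lin0 L_bar Lrho _ L_pos] qs.
have L_lin (c : C) p q : L (c *: p + q) = c * L p + L q by exact: L_lin0.
have L0 : L 0 = 0.
  have := L_lin 1 0 0; rewrite scaler0 addr0 mul1r => h.
  by apply: (addrI (L 0)); rewrite addr0 -h.
have LZ (c : C) p : L (c *: p) = c * L p by have := L_lin c p 0; rewrite !addr0 L0 addr0.
have LD p q : L (p + q) = L p + L q by have := L_lin 1 p q; rewrite scale1r mul1r.
have L_sum (I : Type) (r : seq I) (F : I -> cpoly R n) :
    L (\sum_(i <- r) F i) = \sum_(i <- r) L (F i).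
  by apply: (big_morph L); [exact: LD|exact: L0].
have Lsq : L (nrm2 R n true) = 1.
  rewrite nrm2.unlock /sqnorm L_sum -rho_tr -Lrho /mxtrace; apply: eq_bigr => i _.
  by rewrite [RHS]mxE mul_padj pbarE.
have L1 : L 1 = 1.
  have LB p q : L (p - q) = L p - L q by rewrite -scaleN1r LD LZ mulN1r.
  have h1 : 0 <= L (1 * (1 - nrm2 R n true)).
    by apply/L_pos/qmod_nrm2 => //; exact: sohs1.
  have h2 : 0 <= L (1 * (nrm2 R n true - 1)).
    by apply/L_pos/qmod_nrm2N => //; exact: sohs1.
  move: h1 h2; rewrite !mul1r !LB Lsq !subr_ge0 => h1 h2.
  by apply/eqP; rewrite eq_le h1 h2.
have L_herm h : pbar h = h -> L h = (complex.Re (L h))%:C.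
  move=> hh; rewrite RRe_real //; apply/CrealP.
  by rewrite -L_bar // pbarE hh.
(* [tchakaloff] handles real moments, so each polynomial is replaced by its two Hermitian parts,
   which take real values at points. *)
pose hs := [seq pRe q | q <- qs] ++ [seq pIm q | q <- qs].
have hs_herm h : h \in hs -> pbar h = h.
  by rewrite mem_cat => /orP[] /mapP[q _ ->]; exact: pRe_herm.
pose D := size hs; pose h (i : 'I_D) := nth 0 hs i.
have h_herm i : pbar (h i) = h i by apply: hs_herm; exact: mem_nth.
have X0 : sphere2 !=set0.
  pose u0 : 'cV[C]_n := delta_mx (Ordinal n_gt0) 0.
  have u01 : \sum_i `|u0 i 0| ^+ 2 = 1.
    rewrite (bigD1 (Ordinal n_gt0)) //= big1 => [|i /negPf ii].
      by rewrite mxE !eqxx normr1 expr1n addr0.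
    by rewrite mxE ii normr0 expr0n.
  by exists (zof u0 u0); apply/sphere2P; rewrite xof_zof yof_zof.
pose phi (i : 'I_D) z := complex.Re (ev (xof z) (yof z) (h i)).
have phi_cont i : continuous (phi i) by have [c _] := continuous_ev (h i); exact: c.
have z_pos (a : 'I_D -> R) b :
    (forall z, sphere2 z -> 0 < \sum_i a i * phi i z + b) ->
    0 <= \sum_i a i * complex.Re (L (h i)) + b.
  move=> pos; pose g := \sum_i (a i)%:C *: h i + b%:C *: 1.
  have gh : pbar g = g.
    rewrite /g pbarD pbarZ conj_realC pbar1 pbar_sum; congr (_ + _).
    by apply: eq_bigr => i _; rewrite pbarZ conj_realC h_herm.
  have /L_pos : qmod setT g.
    apply: positivstellensatz => // u v u1 v1.
    have := pos (zof u v); rewrite sphere2P xof_zof yof_zof => /(_ (conj u1 v1)).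
    rewrite /g evD ev_sum evZ ev1 mulr1 ReD Re_sum.
    congr (0 < _ + _); apply: eq_bigr => i _.
    by rewrite evZ ReRM /phi xof_zof yof_zof.
  rewrite /g LD L_sum LZ L1 mulr1 lecE => /andP[_]; rewrite ReD Re_sum.
  congr (0 <= _ + _); apply: eq_bigr => i _.
  by rewrite LZ ReRM.
have [w [pt [w0 w1 ptX wE]]] := tchakaloff sphere2_compact X0 phi_cont z_pos.
pose T (j : 'I_D.+1) : triple R n := (w j, xof (pt j), yof (pt j)).
(* Plans require positive weights, so atoms of weight 0 are discarded. *)
pose e := [seq T j | j <- enum 'I_D.+1 & 0 < w j].
have sum_e (V : lmodType R) (F : triple R n -> V) :
    (forall j, w j = 0 -> F (T j) = 0) -> \sum_(a <- e) F a = \sum_j F (T j).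
  move=> F0; rewrite big_map big_filter big_enum_cond /= big_mkcond /=.
  apply: eq_bigr => j _; case: ltP => // wj; rewrite F0 //.
  by apply/eqP; rewrite eq_le wj w0.
exists e; split.
- move=> a /mapP[j]; rewrite mem_filter => /andP[wj _] ->.
  by have /sphere2P[h1 h2] := ptX j; split=> //; exact/enorm_eq1.
- by rewrite (sum_e R^o (fun a => a.1.1)) // -w1.
have herm_eq i : plan_fun e (h i) = L (h i).
  rewrite (L_herm (h i)) // -wE /plan_fun.
  have evh u v : ev u v (h i) = (complex.Re (ev u v (h i)))%:C.
    by rewrite RRe_real //; apply/CrealP; rewrite -ev_bar h_herm.
  under eq_bigr do rewrite evh -rmorphM /=.
  rewrite -rmorph_sum (sum_e R^o (fun a => a.1.1 * complex.Re (ev a.1.2 a.2 (h i)))) //.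
  by move=> j /= ->; rewrite mul0r.
have plan_D p q : plan_fun e (p + q) = plan_fun e p + plan_fun e q.
  by rewrite /plan_fun -big_split; apply: eq_bigr => a _; rewrite /= evD mulrDr.
have plan_Z c p : plan_fun e (c *: p) = c * plan_fun e p.
  by rewrite /plan_fun mulr_sumr; apply: eq_bigr => a _; rewrite evZ mulrCA.
move=> q qin; rewrite {1}[q]pRe_pIm [in RHS](pRe_pIm q).
rewrite (plan_D (pRe q)) (plan_Z 'i (pIm q)) LD (LZ 'i (pIm q)).
have in_hs g : g \in hs -> plan_fun e g = L g.
  move=> gin; have ig : (index g hs < D)%N by rewrite index_mem.
  by have := herm_eq (Ordinal ig); rewrite /h /= nth_index.
have -> : plan_fun e (pRe q) = L (pRe q).
  by apply: in_hs; rewrite mem_cat map_f.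
rewrite in_hs // mem_cat; apply/orP; right; exact: map_f.
Qed.

End Plans.

Lemma ereal_between (R : realFieldType) (x y : \bar R) : (x < y)%E ->
  exists c : R, (x < c%:E)%E /\ (c%:E < y)%E.
Proof.
case: x y => [r| |] [s| |] //.
- rewrite lte_fin => rs; exists ((r + s) / 2); rewrite !lte_fin; split; lra.
- by move=> _; exists (r + 1); rewrite ltry lte_fin ltrDl ltr01.
- by move=> _; exists (s - 1); rewrite ltNyr lte_fin gtrDl oppr_lt0 ltr01.
- by move=> _; exists 0; rewrite ltNyr ltry.
Qed.

(** * Spectral decomposition of states and existence of transport plans *)

Section Decomposition.
Variables (R : realType) (n : nat).
Notation C := R[i].

Lemma density_decomp (rho : 'M[C]_n) : density rho ->
  exists s : seq (R * 'cV[C]_n),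
  [/\ forall a, a \in s -> 0 < a.1 /\ \sum_i `|a.2 i 0| ^+ 2 = 1,
      \sum_(a <- s) a.1 = 1
    & \sum_(a <- s) a.1%:C *: (a.2 *m a.2 ^t*) = rho].
Proof.
move=> [rho_herm rho_pos rho_tr].
have normal : rho \is normalmx by apply/normalmxP; rewrite rho_herm.
have /orthomx_spectralP := normal.
set P := spectralmx rho; set d := spectral_diag rho.
have PU : P \is unitarymx := spectral_unitarymx rho.
rewrite invmx_unitary // => rhoE.
have PP : P *m P ^t* = 1%:M by apply/unitarymxP.
(* The spectral theorem reads [rho = P^* diag(d) P], so the eigenvectors are the adjoints of the
   rows of [P]. *)
pose u k : 'cV[C]_n := (row k P) ^t*.
have uE k i : u k i 0 = (P k i)^* by rewrite !mxE.
have outerE k i j : (u k *m (u k) ^t*) i j = (P k i)^* * P k j.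
  by rewrite mxE big_ord1 uE !mxE conjCK.
have u1 k : \sum_i `|u k i 0| ^+ 2 = 1.
  have : (P *m P ^t*) k k = 1 by rewrite PP mxE eqxx.
  rewrite mxE => <-; apply: eq_bigr => i _.
  by rewrite uE norm_conjC normCK !mxE.
have rho_sum : rho = \sum_k d 0 k *: (u k *m (u k) ^t*).
  apply/matrixP => i j; rewrite {1}rhoE summxE mxE; apply: eq_bigr => k _.
  rewrite [RHS]mxE outerE mul_mx_diag !mxE mulrA; congr (_ * _).
  by rewrite mulrC.
have d0 k : 0 <= d 0 k.
  have -> : d 0 k = ((u k) ^t* *m rho *m u k) 0 0; last exact: rho_pos.
  have -> : (u k) ^t* = row k P by rewrite trmxCK.
  have -> : (row k P *m rho *m u k) 0 0 = (P *m rho *m P ^t*) k k.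
    rewrite -row_mul !mxE; apply: eq_bigr => j _.
    by rewrite uE [row k _ _ _]mxE !mxE.
  rewrite {1}rhoE !mulmxA PP mul1mx -mulmxA PP mulmx1.
  by rewrite mxE eqxx mulr1n.
have dE k : d 0 k = (complex.Re (d 0 k))%:C by rewrite RRe_real // ger0_real.
pose w k := complex.Re (d 0 k).
have w0 k : 0 <= w k by rewrite -ler0c -dE.
pose T k := (w k, u k).
pose s := [seq T k | k <- enum 'I_n & 0 < w k].
have sum_s (V : zmodType) (F : R * 'cV[C]_n -> V) :
    (forall k, w k = 0 -> F (T k) = 0) -> \sum_(a <- s) F a = \sum_k F (T k).
  move=> F0; rewrite big_map big_filter big_enum_cond /= big_mkcond /=.
  apply: eq_bigr => k _; case: ltP => // wk; rewrite F0 //.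
  by apply/eqP; rewrite eq_le wk w0.
exists s; split.
- by move=> a /mapP[k]; rewrite mem_filter => /andP[wk _] ->; split; [exact: wk|exact: u1].
- rewrite sum_s //=; apply: (@complexI R); rewrite rmorph1 rmorph_sum /=.
  rewrite -rho_tr rho_sum raddf_sum /=; apply: eq_bigr => k _.
  rewrite mxtraceZ -dE /mxtrace.
  have -> : \sum_i (u k *m (u k) ^t*) i i = 1; last by rewrite mulr1.
  by rewrite -(u1 k); apply: eq_bigr => i _; rewrite outerE uE norm_conjC normCK mulrC.
- rewrite sum_s => [|k /= ->]; last by rewrite scale0r.
  by rewrite rho_sum; apply: eq_bigr => k _; rewrite /= -dE.
Qed.

(** The independent coupling of two spectral decompositions. *)
Lemma transport_plan_nonempty (rho nu : 'M[C]_n) : density rho -> density nu ->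
  transport_plan rho nu !=set0.
Proof.
move=> /density_decomp[s [sP s1 srho]] /density_decomp[s' [s'P s'1 s'nu]].
exists [seq (a.1 * b.1, a.2, b.2) | a <- s, b <- s']; split.
- move=> _ /allpairsP[[a b] /= [/sP[a0 a1] /s'P[b0 b1] ->]] /=.
  by split; [exact: mulr_gt0|exact/enorm_eq1|exact/enorm_eq1].
- rewrite big_allpairs_dep -[RHS]s1; apply: eq_bigr => a _ /=.
  by rewrite -mulr_sumr s'1 mulr1.
- rewrite big_allpairs_dep -srho; apply: eq_bigr => a _ /=.
  by rewrite -scaler_suml -rmorph_sum -mulr_sumr s'1 mulr1.
- rewrite big_allpairs_dep exchange_big -s'nu; apply: eq_bigr => b _ /=.
  by rewrite -scaler_suml -rmorph_sum -mulr_suml s1 mul1r.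
Qed.

End Decomposition.

(** * Weak duality *)

Section Weak.
Variables (R : realType) (n : nat) (D : set (cpoly R n)) (rho nu : 'M[R[i]]_n).
Notation C := R[i].
Notation f := (cost_poly R n).
Hypothesis D_lin : forall (c : C) p q, D p -> D q -> D (c *: p + q).
Hypothesis D_deg : deg_le 4 `<=` D.

Lemma weak_duality L A B : feasible D (qmod D) rho nu L ->
  qmod D (f - qform (xvec R n) A - qform (yvec R n) B) ->
  complex.Re (\tr (rho *m A + nu *m B)) <= complex.Re (L f).
Proof.
move=> [L_lin _ Lrho Lnu L_pos] /L_pos; rewrite (qformE true) (qformE false).
have D0 : D 0 by exact/D_deg/deg_le0.
have DZ (c : C) p : D p -> D (c *: p).
  by move=> Dp; have := D_lin c Dp D0; rewrite addr0.
have L0 : L 0 = 0.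
  have := L_lin 1 0 0 D0 D0; rewrite scaler0 addr0 mul1r => h.
  by apply: (addrI (L 0)); rewrite addr0 -h.
have LZ (c : C) p : D p -> L (c *: p) = c * L p.
  by move=> Dp; have := L_lin c p 0 Dp D0; rewrite !addr0 L0 addr0.
have LD p q : D p -> D q -> L (p + q) = L p + L q.
  by move=> Dp Dq; have := L_lin 1 p q Dp Dq; rewrite scale1r mul1r.
have D_sum (I : Type) (r : seq I) (F : I -> cpoly R n) :
    (forall i, D (F i)) -> D (\sum_(i <- r) F i).
  move=> DF; elim: r => [|i r IH]; rewrite ?big_nil ?big_cons //.
  by have := D_lin 1 (DF i) IH; rewrite scale1r.
have L_sum (I : Type) (r : seq I) (F : I -> cpoly R n) :
    (forall i, D (F i)) -> L (\sum_(i <- r) F i) = \sum_(i <- r) L (F i).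
  move=> DF; elim: r => [|i r IH]; first by rewrite !big_nil.
  by rewrite !big_cons LD ?IH //; exact: D_sum.
have Dm b i j : D (pbar (block_vec R n b i 0) * block_vec R n b j 0).
  by apply: D_deg; rewrite mulrC; exact: (deg_leW _ (deg_outer_block R b j i)).
have Dm' b i j (c : C) : D (c *: (pbar (block_vec R n b i 0) * block_vec R n b j 0)).
  exact: DZ.
have L_qf b M : L (block_form b M) = \tr ((if b then rho else nu) *m M).
  have entry i j : L (pbar (block_vec R n b i 0) * block_vec R n b j 0) =
      (if b then rho else nu) j i.
    by rewrite mulrC; case: b; [rewrite -Lrho|rewrite -Lnu]; rewrite [RHS]mxE mul_padj.
  rewrite /block_form L_sum => [|i]; last exact: D_sum.
  rewrite /mxtrace; under [RHS]eq_bigr do rewrite mxE.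
  rewrite exchange_big; apply: eq_bigr => i _ /=; rewrite L_sum //.
  by apply: eq_bigr => j _; rewrite LZ // entry mulrC.
have Dqf b M : D (block_form b M) by exact/D_deg/(deg_leW _ (deg_block_form _ _)).
have Df : D f by exact/D_deg/deg_cost.
have DN p : D p -> D (- p) by move=> Dp; rewrite -scaleN1r; exact: DZ.
have DD p q : D p -> D q -> D (p + q).
  by move=> Dp Dq; have := D_lin 1 Dp Dq; rewrite scale1r.
have LN p : D p -> L (- p) = - L p by move=> Dp; rewrite -scaleN1r LZ // mulN1r.
rewrite LD; [|by apply: DD => //; exact: DN|exact: DN].
rewrite LD ?LN //; last exact: DN.
rewrite !L_qf mxtraceD lecE => /andP[_]; rewrite !ReD /=.
move: (\tr (rho *m A)) (\tr (nu *m B)) (L f) => [a a'] [b b'] [c c'] /=; lra.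
Qed.

End Weak.

Lemma plan_fun_outer (R : realType) (n : nat) (e : seq (triple R n)) b i j :
  (\sum_(a <- e) a.1.1%:C *: ((if b then a.1.2 else a.2) *m
     (if b then a.1.2 else a.2) ^t*)) i j =
  plan_fun e (block_vec R n b i 0 * pbar (block_vec R n b j 0)).
Proof.
rewrite summxE; apply: eq_bigr => a _.
by rewrite ev_outer_block mxE; case: b.
Qed.

(** * Absence of a gap, convergence, and the value of the limit *)

Section Main.
Variables (R : realType) (n : nat) (rho nu : 'M[R[i]]_n).
Notation C := R[i].
Notation f := (cost_poly R n).
Hypotheses (n_gt0 : (0 < n)%N) (rhoD : density rho) (nuD : density nu).
Local Open Scope ereal_scope.

Let dlin k (c : C) (p q : cpoly R n) : deg_le k p -> deg_le k q -> deg_le k (c *: p + q)%R.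
Proof. by move=> dp dq; apply: deg_leD => //; exact: deg_leZ. Qed.

Let deg4 t : (2 <= t)%N -> @deg_le R n 4 `<=` deg_le (2 * t).
Proof. by move=> t2 p; apply: deg_leW; rewrite (leq_mul2l 2 2). Qed.

Lemma trunc_duality t : (2 <= t)%N -> W2sq_trunc rho nu t = dual_trunc rho nu t.
Proof.
move=> t2; apply/eqP; rewrite eq_le; apply/andP; split; last first.
  apply: ge_ereal_sup => _ [[A B] [/= _ _ Q] <-].
  apply: le_ereal_inf_tmp => _ [L Lf <-]; rewrite lee_fin.
  by apply: (@weak_duality _ _ (deg_le (2 * t))) Q => //; [exact: dlin|exact: deg4].
(* At a real [c] strictly between the two values, a dual point of value [c] contradicts [dc], and a
   functional of value at most [c] contradicts [cw]. *)
rewrite leNgt; apply/negP => /ereal_between[c [dc cw]].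
have [rho_herm _ rho_tr] := rhoD; have [nu_herm _ nu_tr] := nuD.
have [[LG [h1 h2 h3 h4]]|[L Lf Lc]] := @dual_or_primal R n (deg_le (2 * t)) rho nu
    (@dlin _) (@deg_le_pbar R n _) (deg4 t2) (fun p dp ph => qmod_order_unit ph dp)
    rho_herm nu_herm rho_tr c.
  move: dc; rewrite ltNge => /negP; apply; apply: ereal_sup_ubound.
  by exists LG => //; rewrite h4.
move: cw; rewrite ltNge => /negP; apply.
apply: le_trans (_ : (complex.Re (L f))%:E <= _); last by rewrite lee_fin.
by apply: ereal_inf_lbound; exists L.
Qed.

Lemma qmodT_trunc (q : cpoly R n) : qmod setT q -> exists2 t, (2 <= t)%N & qmod (deg_le (2 * t)) q.
Proof.
move=> [s sP ->].
have /choice[d dP] : forall j, exists d, deg_le d (s j * tnth (sphere_gens R n) j)%R.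
  by move=> j; exact: deg_le_exists.
exists (2 + \sum_j d j)%N; first exact: leq_addr.
exists s => // j; split; first by case: (sP j).
apply: (deg_leW _ (dP j)); rewrite (bigD1 j) //= mulnDr.
by rewrite mulnDr (@leq_trans (2 * d j)) // ?leq_pmull // addnCA leq_addr.
Qed.

Lemma infty_le_sup : W2sq_infty rho nu <= ereal_sup (range (W2sq_trunc rho nu)).
Proof.
rewrite leNgt; apply/negP => /ereal_between[c [sc cw]].
have [rho_herm _ rho_tr] := rhoD; have [nu_herm _ nu_tr] := nuD.
have unit (p : cpoly R n) : setT p -> pbar p = p -> exists r : R, qmod setT (r%:C%C *: 1 + p)%R.
  move=> _ ph; have [d dp] := deg_le_exists p.
  have d2 : deg_le (2 * d) p by apply: (deg_leW _ dp); rewrite leq_pmull.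
  by have [r rP] := qmod_order_unit ph d2; exists r; exact: qmod_sub rP.
have [[[A B] [/= h1 h2 h3 h4]]|[L Lf Lc]] := @dual_or_primal R n setT rho nu
    (fun _ _ _ _ _ => I) (fun _ _ => I) (fun _ _ => I) unit
    rho_herm nu_herm rho_tr c.
  have [t t2 Qt] := qmodT_trunc h3.
  move: sc; rewrite ltNge => /negP; apply.
  apply: le_trans (_ : W2sq_trunc rho nu t <= _); last by apply: ereal_sup_ubound; exists t.
  rewrite trunc_duality //; apply: ereal_sup_ubound; exists (A, B) => //=.
  by rewrite h4.
move: cw; rewrite ltNge => /negP; apply.
apply: le_trans (_ : (complex.Re (L f))%:E <= _); last by rewrite lee_fin.
by apply: ereal_inf_lbound; exists L => //; rewrite qmoduleE.
Qed.

Lemma feasible_sub (D D' Q Q' : set (cpoly R n)) : D `<=` D' -> Q `<=` Q' ->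
  feasible D' Q' rho nu `<=` feasible D Q rho nu.
Proof.
move=> DD QQ L [h1 h2 h3 h4 h5]; split=> //.
- by move=> c p q /DD Dp /DD; exact: h1.
- by move=> p /DD; exact: h2.
- by move=> q /QQ; exact: h5.
Qed.

Lemma moment_value_le (D D' Q Q' : set (cpoly R n)) : D `<=` D' -> Q `<=` Q' ->
  moment_value D Q rho nu <= moment_value D' Q' rho nu.
Proof.
move=> DD QQ; apply: le_ereal_inf => _ [L Lf <-]; exists L => //.
exact: feasible_sub Lf.
Qed.

Lemma trunc_cvg : W2sq_trunc rho nu t @[t --> \oo] --> W2sq_infty rho nu.
Proof.
(* The supremum also runs over [t < 2]. This is harmless: the comparison by restriction of
   functionals holds for all domains. *)
have -> : W2sq_infty rho nu = ereal_sup (range (W2sq_trunc rho nu)).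
  apply/eqP; rewrite eq_le infty_le_sup /=; apply: ge_ereal_sup => _ [t _ <-].
  by apply: moment_value_le => //; rewrite qmoduleE; exact: qmod_sub.
apply: ereal_nondecreasing_cvgn => s t st.
have sub : @deg_le R n (2 * s) `<=` deg_le (2 * t).
  by move=> p; apply: deg_leW; rewrite leq_mul2l st orbT.
by apply: moment_value_le => //; exact: qmod_sub.
Qed.

Lemma infty_eq : W2sq_infty rho nu = (complex.Re (W2 rho nu ^+ 2)%R)%:E.
Proof.
(* The real infimum agrees with the extended one once the set is nonempty and bounded below; the
   lower bound [- r] comes from [r + f] being in the quadratic module. *)
rewrite W2_sqr /= /W2_cost -ereal_inf_EFin; last 2 first.
- have [d df] := deg_le_exists f.
  have d2 : deg_le (2 * d) f by apply: (deg_leW _ df); rewrite leq_pmull.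
  have [r /(qmod_sub (fun _ _ => I)) Qr] := qmod_order_unit (cost_herm R n) d2.
  exists (- r)%R => _ [e eP <-].
  have [L_lin _ _ _ /(_ _ Qr)] := plan_feasible eP.
  have [_ e1 _ _] := eP.
  have -> : plan_fun e (r%:C%C *: 1 + f)%R = (r%:C%C + T2 e)%R.
    rewrite L_lin // T2E; congr (_ + _)%R; rewrite /plan_fun.
    under eq_bigr do rewrite ev1 mulr1.
    by rewrite -rmorph_sum e1 mulr1.
  by rewrite lecE => /andP[_]; rewrite ReD /=; lra.
- by have [e eP] := transport_plan_nonempty rhoD nuD; exists (complex.Re (T2 e)), e.
rewrite /W2sq_infty qmoduleE; congr ereal_inf; apply/seteqP.
split=> [_ [L Lf <-]|_ [_ [e eP <-] <-]]; last first.
  by exists (plan_fun e); [exact: plan_feasible|rewrite T2E].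
have [_ _ rho_tr] := rhoD.
pose o b i j := (block_vec R n b i 0 * pbar (block_vec R n b j 0))%R.
pose os b := [seq o b i j | i <- enum 'I_n, j <- enum 'I_n].
(* Matching the moments of the outer products forces the marginals [rho] and [nu]; matching that of
   [f] gives the cost. *)
have [e [eP e1 eL]] := moment_plan rho_tr n_gt0 Lf (f :: os true ++ os false).
have o_os b i j : o b i j \in f :: os true ++ os false.
  rewrite inE mem_cat; apply/orP; right.
  have : o b i j \in os b by apply/allpairsP; exists (i, j); rewrite !mem_enum.
  by case: b => ->; rewrite ?orbT.
have plan_entry b : (\sum_(a <- e) a.1.1%:C%C *: ((if b then a.1.2 else a.2) *m
    (if b then a.1.2 else a.2) ^t*))%R = if b then rho else nu.
  apply/matrixP => i j; case: Lf => _ _ Lrho Lnu _.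
  rewrite plan_fun_outer (eL _ (o_os b i j)).
  by rewrite /o; case: b; [rewrite -Lrho|rewrite -Lnu]; rewrite [RHS]mxE mul_padj.
exists (complex.Re (T2 e)); last by rewrite T2E eL ?mem_head.
exists e => //; split => //; first exact: (plan_entry true).
exact: (plan_entry false).
Qed.

End Main.

Theorem theorem10 (R : realType) (n : nat) (hn : (1 <= n)%N)
    (rho nu : 'M[R[i]]_n) (hrho : density rho) (hnu : density nu) :
  (forall t : nat, (2 <= t)%N -> W2sq_trunc rho nu t = dual_trunc rho nu t) /\
  (W2sq_trunc rho nu t @[t --> \oo] --> W2sq_infty rho nu) /\
  W2sq_infty rho nu = (complex.Re (W2 rho nu ^+ 2))%:E.
Proof.
split; first by move=> t; exact: trunc_duality.
by split; [exact: trunc_cvg|exact: infty_eq].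
Qed.
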